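(* Let $\Phi:U_\hbar(L\mathfrak g)\to\widehat{Y_\hbar(\mathfrak g)}$ be a homomorphism of geometric type with series $\{g_i^\pm(v)\}_{i\in\mathbf I}$, let $d_i^\pm\in\mathbb C^\times$ be the constants with $d_i^+d_i^-=d_i$ such that $g_i^\pm(v)=\frac1{d_i^\pm}\bmod\widehat{Y^0[v]}_+$, and let $\mathrm{gr}(\Phi):\mathrm{gr}_{\mathcal J}(U_\hbar(L\mathfrak g))\to Y_\hbar(\mathfrak g)$ be the induced map of associated graded algebras. Then $\mathrm{gr}(\Phi)$ is the inverse of the degeneration isomorphism $\imath:Y_\hbar(\mathfrak g)\to\mathrm{gr}_{\mathcal J}(U_\hbar(L\mathfrak g))$ corresponding to the constants $d_i^\pm$.
   Context: **Lie algebra.** $\mathfrak g$ is a complex semisimple Lie algebra, $\mathfrak h$ a Cartan subalgebra, $\{\alpha_i\}_{i\in\mathbf I}$ simple roots, $(\cdot,\cdot)$ a non-degenerate invariant bilinear form, $a_{ij}=2(\alpha_i,\alpha_j)/(\alpha_i,\alpha_i)$, $d_i=(\alpha_i,\alpha_i)/2$. $\hbar$ is formal, $q=e^{\hbar/2}$, $q_i=e^{\hbar d_i/2}$, $[n]_q=\frac{q^n-q^{-n}}{q-q^{-1}}$, $[n]_q!=[n]_q\cdots[1]_q$, $\left[{m\atop s}\right]_q=\frac{[m]_q!}{[s]_q![m-s]_q!}$. **Quantum loop algebra.** $U_\hbar(L\mathfrak g)$ is the unital associative $\mathbb C[[\hbar]]$-algebra topologically generated by $\{E_{i,k},F_{i,k},H_{i,k}\}_{i\in\mathbf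 I,k\in\mathbb Z}$ with relations: (QL1) $[H_{i,r},H_{j,s}]=0$. (QL2) $[H_{i,0},E_{j,k}]=a_{ij}E_{j,k}$, $[H_{i,0},F_{j,k}]=-a_{ij}F_{j,k}$. (QL3) for $r\ne0$, $[H_{i,r},E_{j,k}]=\frac{[ra_{ij}]_{q_i}}{r}E_{j,r+k}$, $[H_{i,r},F_{j,k}]=-\frac{[ra_{ij}]_{q_i}}{r}F_{j,r+k}$. (QL4) $E_{i,k+1}E_{j,l}-q_i^{a_{ij}}E_{j,l}E_{i,k+1}=q_i^{a_{ij}}E_{i,k}E_{j,l+1}-E_{j,l+1}E_{i,k}$ and $F_{i,k+1}F_{j,l}-q_i^{-a_{ij}}F_{j,l}F_{i,k+1}=q_i^{-a_{ij}}F_{i,k}F_{j,l+1}-F_{j,l+1}F_{i,k}$. (QL5) $[E_{i,k},F_{j,l}]=\delta_{ij}\frac{\psi_{i,k+l}-\phi_{i,k+l}}{q_i-q_i^{-1}}$. (QL6) for $i\ne j$, $m=1-a_{ij}$, $k_1,\dots,k_m,l\in\mathbb Z$: $\sum_{\pi\in\mathfrak S_m}\sum_{s=0}^m(-1)^s\left[{m\atop s}\right]_{q_i}E_{i,k_{\pi(1)}}\cdots E_{i,k_{\pi(s)}}E_{j,l}E_{i,k_{\pi(s+1)}}\cdots E_{i,k_{\pi(m)}}=0$, and the same with $F$ in place of $E$. Here $\psi_i(z)=\sum_{r\ge0}\psi_{i,r}z^{-r}=\exp(\frac{\hbar d_i}{2}H_{i,0})\exp((q_i-q_i^{-1})\sum_{s\ge1}H_{i,s}z^{-s})$,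 $\phi_i(z)=\sum_{r\ge0}\phi_{i,-r}z^{r}=\exp(-\frac{\hbar d_i}{2}H_{i,0})\exp(-(q_i-q_i^{-1})\sum_{s\ge1}H_{i,-s}z^{s})$, and $\psi_{i,-k}=\phi_{i,k}=0$ for $k\ge1$. **Yangian.** $Y_\hbar(\mathfrak g)$ is the unital associative $\mathbb C[\hbar]$-algebra generated by $\{x^\pm_{i,r},\xi_{i,r}\}_{i\in\mathbf I,r\in\mathbb N}$ with relations: (Y1) $[\xi_{i,r},\xi_{j,s}]=0$. (Y2) $[\xi_{i,0},x^\pm_{j,s}]=\pm d_ia_{ij}x^\pm_{j,s}$. (Y3) $[\xi_{i,r+1},x^\pm_{j,s}]-[\xi_{i,r},x^\pm_{j,s+1}]=\pm\frac{d_ia_{ij}\hbar}{2}(\xi_{i,r}x^\pm_{j,s}+x^\pm_{j,s}\xi_{i,r})$. (Y4) $[x^\pm_{i,r+1},x^\pm_{j,s}]-[x^\pm_{i,r},x^\pm_{j,s+1}]=\pm\frac{d_ia_{ij}\hbar}{2}(x^\pm_{i,r}x^\pm_{j,s}+x^\pm_{j,s}x^\pm_{i,r})$. (Y5) $[x^+_{i,r},x^-_{j,s}]=\delta_{ij}\xi_{i,r+s}$. (Y6) for $i\ne j$, $m=1-a_{ij}$: $\sum_{\pi\in\mathfrak S_m}[x^\pm_{i,r_{\pi(1)}},[x^\pm_{i,r_{\pi(2)}},\dots,[x^\pm_{i,r_{\pi(m)}},x^\pm_{j,s}]\cdots]]=0$. It is $\mathbb N$-graded by $\deg\xi_{i,r}=\deg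 x^\pm_{i,r}=r$, $\deg\hbar=1$, with degree $n$ part $Y_\hbar(\mathfrak g)_n$; $\widehat{Y_\hbar(\mathfrak g)}=\prod_{n\ge0}Y_\hbar(\mathfrak g)_n$. $Y^0$ is the commutative subalgebra generated by the $\xi_{i,r}$, $\widehat{Y^0[v]}$ the completion of $Y^0[v]$ for the grading with $\deg v=1$, and $\widehat{Y^0[v]}_+$ its ideal of series of positive degree elements. The elements $t_{i,r}\in Y^0$ are defined by $\hbar\sum_{r\ge0}t_{i,r}u^{-r-1}=\log(1+\hbar\sum_{r\ge0}\xi_{i,r}u^{-r-1})$. **Homomorphisms of geometric type.** An algebra homomorphism $\Phi:U_\hbar(L\mathfrak g)\to\widehat{Y_\hbar(\mathfrak g)}$ is of geometric type if $\Phi(H_{i,0})=d_i^{-1}t_{i,0}$, $\Phi(H_{i,r})=\frac{\hbar}{q_i-q_i^{-1}}\sum_{k\ge0}t_{i,k}\frac{r^k}{k!}$ for $r\ne0$, and there are series $g_i^\pm(v)=\sum_{m\ge0}g^\pm_{i,m}v^m\in\widehat{Y^0[v]}$ such that $\Phi(E_{i,0})=\sum_{m\ge0}g^+_{i,m}x^+_{i,m}$ and $\Phi(F_{i,0})=\sum_{m\ge0}g^-_{i,m}x^-_{i,m}$ for all $i\in\mathbf I$. For such $\Phi$, constants $d_i^\pm\in\mathbb C^\times$ with $d_i^+d_i^-=d_i$ and $g_i^\pm(v)=1/d_i^\pm\bmod\widehat{Y^0[v]}_+$ always exist. **Filtration and degeneration.** $\mathcal J$ is the kernel of $U_\hbar(L\mathfrak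 g)\xrightarrow{\hbar\to0}U(\mathfrak g[z,z^{-1}])\xrightarrow{z\to1}U\mathfrak g$, and $\mathrm{gr}_{\mathcal J}(U_\hbar(L\mathfrak g))=\bigoplus_{n\ge0}\mathcal J^n/\mathcal J^{n+1}$. A homomorphism of geometric type maps $\mathcal J^n$ into $\prod_{m\ge n}Y_\hbar(\mathfrak g)_m$ and so induces the graded map $\mathrm{gr}(\Phi)$. For given $d_i^\pm\in\mathbb C^\times$ with $d_i^+d_i^-=d_i$, it is known that there is a unique isomorphism of graded algebras $\imath:Y_\hbar(\mathfrak g)\to\mathrm{gr}_{\mathcal J}(U_\hbar(L\mathfrak g))$ with $\xi_{i,0}\mapsto d_iH_{i,0}$, $x^+_{i,0}\mapsto d_i^+E_{i,0}$, $x^-_{i,0}\mapsto d_i^-F_{i,0}$ in $U_\hbar(L\mathfrak g)/\mathcal J$ and $x^+_{i,1}\mapsto d_i^+(E_{i,1}-E_{i,0})$, $x^-_{i,1}\mapsto d_i^-(F_{i,1}-F_{i,0})$ in $\mathcal J/\mathcal J^2$. *)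

(* Defs.v *)
From HB Require Import structures.
From mathcomp Require Import all_boot all_order all_fingroup all_algebra.
From mathcomp Require Import boolp classical_sets functions cardinality fsbigop.
From mathcomp Require Import reals complex monalg.

Set Implicit Arguments.
Unset Strict Implicit.
Unset Printing Implicit Defensive.

Import GRing.Theory Num.Theory.
Local Open Scope ring_scope.
#[local] Obligation Tactic := idtac.

Record fps (A : Type) := Fps { fcoef :> nat -> A }.

HB.instance Definition _ (A : Type) := [isNew for @fcoef A].
HB.instance Definition _ (A : Type) := gen_eqMixin (fps A).
HB.instance Definition _ (A : Type) := gen_choiceMixin (fps A).

Lemma fpsP (A : Type) (f g : fps A) : (forall n, f n = g n) <-> f = g.
Proof.
split=> [|-> //]; case: f g => [f] [g] /= fg.
by congr Fps; apply: funext.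
Qed.

(* Ring operations are locked, as unification would otherwise unfold them. *)
Fact ops_key : unit. Proof. by []. Qed.

Section FpsZmodule.
Variable A : zmodType.
Implicit Types f g : fps A.

Definition fps_zero : fps A := Fps (fun=> 0).
Definition fps_opp f : fps A := Fps (fun n => - f n).
Definition fps_add f g : fps A := Fps (fun n => f n + g n).

Fact fps_addA : associative fps_add.
Proof. by move=> f g h; apply/fpsP => n /=; rewrite addrA. Qed.
Fact fps_addC : commutative fps_add.
Proof. by move=> f g; apply/fpsP => n /=; rewrite addrC. Qed.
Fact fps_add0 : left_id fps_zero fps_add.
Proof. by move=> f; apply/fpsP => n /=; rewrite add0r. Qed.
Fact fps_addN : left_inverse fps_zero fps_opp fps_add.
Proof. by move=> f; apply/fpsP => n /=; rewrite addNr. Qed.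

HB.instance Definition _ :=
  GRing.isZmodule.Build (fps A) fps_addA fps_addC fps_add0 fps_addN.

Lemma fcoef0 n : (0 : fps A) n = 0. Proof. by []. Qed.
Lemma fcoefD f g n : (f + g) n = f n + g n. Proof. by []. Qed.
Lemma fcoefN f n : (- f) n = - f n. Proof. by []. Qed.

Definition fps_mono (n : nat) (a : A) : fps A :=
  Fps (fun k => if k == n then a else 0).

End FpsZmodule.

Notation fpsC := (fps_mono 0).

Section FpsRing.
Variable A : pzRingType.
Implicit Types f g h : fps A.

Definition fps_mul : fps A -> fps A -> fps A := locked_with ops_key (fun f g =>
  Fps (fun n => \sum_(k < n.+1) f k * g (n - k)%N)).

Lemma fps_mulE f g n :
  fps_mul f g n = \sum_(k < n.+1) f k * g (n - k)%N.
Proof. by rewrite /fps_mul unlock. Qed.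

Lemma fps_mul_rev f g n :
  fps_mul f g n = \sum_(k < n.+1) f (n - k)%N * g k.
Proof.
rewrite fps_mulE (reindex_inj rev_ord_inj) /=.
by apply: eq_bigr => k _; rewrite subSS subKn // -ltnS.
Qed.

Fact fps_mulA : associative fps_mul.
Proof.
move=> f g h; apply/fpsP => n; rewrite [RHS]fps_mul_rev [LHS]fps_mulE.
pose c3 j k := f j * (g (n - j - k)%N * h k).
transitivity (\sum_(j < n.+1) \sum_(k < n.+1 | (k <= n - j)%N) c3 j k).
  apply: eq_bigr => /= j _; rewrite fps_mul_rev big_distrr /=.
  by rewrite (big_ord_narrow_leq (leq_subr _ _)).
rewrite (exchange_big_dep predT) //=; apply: eq_bigr => k _.
transitivity (\sum_(j < n.+1 | (j <= n - k)%N) c3 j k).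
  apply: eq_bigl => j; rewrite -ltnS -(ltnS j) -!subSn ?leq_ord //.
  by rewrite -subn_gt0 -(subn_gt0 j) -!subnDA addnC.
rewrite (big_ord_narrow_leq (leq_subr _ _)) /=.
by rewrite fps_mulE big_distrl /=; apply: eq_bigr => j _;
  rewrite /c3 -!subnDA addnC mulrA.
Qed.

Fact fps_mul1 : left_id (fpsC 1) fps_mul.
Proof.
move=> f; apply/fpsP => n; rewrite fps_mulE big_ord_recl /= mul1r subn0.
by rewrite big1 ?addr0 // => k _; rewrite mul0r.
Qed.
Fact fps_mulr1 : right_id (fpsC 1) fps_mul.
Proof.
move=> f; apply/fpsP => n; rewrite fps_mul_rev big_ord_recl /= mulr1 subn0.
by rewrite big1 ?addr0 // => k _; rewrite mulr0.
Qed.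
Fact fps_mulDl : left_distributive fps_mul +%R.
Proof.
move=> f g h; apply/fpsP => n; rewrite fcoefD !fps_mulE -big_split /=.
by apply: eq_bigr => k _; rewrite mulrDl.
Qed.
Fact fps_mulDr : right_distributive fps_mul +%R.
Proof.
move=> f g h; apply/fpsP => n; rewrite fcoefD !fps_mulE -big_split /=.
by apply: eq_bigr => k _; rewrite mulrDr.
Qed.

HB.instance Definition _ := GRing.Zmodule_isPzRing.Build (fps A)
  fps_mulA fps_mul1 fps_mulr1 fps_mulDl fps_mulDr.

Lemma fcoefM f g n : (f * g) n = \sum_(k < n.+1) f k * g (n - k)%N.
Proof. exact: fps_mulE. Qed.
Lemma fcoef1 n : (1 : fps A) n = (n == 0)%:R.
Proof. by rewrite /=; case: eqP. Qed.

End FpsRing.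

Section FpsNzRing.
Variable A : nzRingType.

Fact fps_oner_neq0 : (1 : fps A) != 0.
Proof.
by apply/eqP => /fpsP /(_ 0); rewrite fcoef1 fcoef0; apply/eqP/oner_neq0.
Qed.
HB.instance Definition _ :=
  GRing.PzSemiRing_isNonZero.Build (fps A) fps_oner_neq0.
End FpsNzRing.

Section FpsComRing.
Variable K : comNzRingType.

Fact fps_mulC : commutative (@GRing.mul (fps K)).
Proof.
move=> f g; apply/fpsP => n; rewrite fcoefM -[RHS]/(fps_mul g f n) fps_mul_rev.
by apply: eq_bigr => k _; rewrite mulrC.
Qed.
HB.instance Definition _ :=
  GRing.PzRing_hasCommutativeMul.Build (fps K) fps_mulC.

Definition fps_unit : pred (fps K) := fun f => `[< exists g, g * f = 1 >].
Definition fps_inv (f : fps K) : fps K :=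
  xget f [set g | g * f = 1]%classic.

Fact fps_mulVf : {in fps_unit, left_inverse 1 fps_inv *%R}.
Proof.
move=> f /asboolP [g gf]; rewrite /fps_inv.
by case: xgetP => [h _ //|] /(_ g) /=; rewrite gf.
Qed.
Fact fps_unitP f g : g * f = 1 -> fps_unit f.
Proof. by move=> gf; apply/asboolP; exists g. Qed.
Fact fps_inv_out : {in [predC fps_unit], fps_inv =1 id}.
Proof.
move=> f; rewrite inE => /asboolPn uf; rewrite /fps_inv.
by case: xgetP => // g _ gf; case: uf; exists g.
Qed.
HB.instance Definition _ := GRing.ComNzRing_hasMulInverse.Build (fps K)
  fps_mulVf fps_unitP fps_inv_out.
End FpsComRing.

Section FpsAlgebra.
Variables (K : comNzRingType) (A : lalgType K).

Definition fps_in_alg (c : fps K) : fps A := Fps (fun n => (c n)%:A).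
Definition fps_scale (c : fps K) (f : fps A) : fps A := fps_in_alg c * f.

Lemma fps_in_algM (b c : fps K) :
  fps_in_alg (b * c) = fps_in_alg b * fps_in_alg c.
Proof.
apply/fpsP => n; rewrite fcoefM /= fcoefM scaler_suml; apply: eq_bigr => k _.
by rewrite -scalerA -scalerAl mul1r.
Qed.
Lemma fps_in_algD (b c : fps K) :
  fps_in_alg (b + c) = fps_in_alg b + fps_in_alg c.
Proof. by apply/fpsP => n; rewrite fcoefD /= scalerDl. Qed.
Lemma fps_in_alg1 : fps_in_alg 1 = 1.
Proof.
by apply/fpsP => -[|n]; rewrite !fcoef1 /= ?scale1r ?scale0r.
Qed.

Fact fps_scalerA b c f : fps_scale b (fps_scale c f) = fps_scale (b * c) f.
Proof. by rewrite /fps_scale mulrA fps_in_algM. Qed.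
Fact fps_scale1r : left_id 1 fps_scale.
Proof. by move=> f; rewrite /fps_scale fps_in_alg1 mul1r. Qed.
Fact fps_scalerDr : right_distributive fps_scale +%R.
Proof. by move=> c f g; apply: mulrDr. Qed.
Fact fps_scalerDl f : {morph fps_scale^~ f : b c / b + c}.
Proof. by move=> b c; rewrite /fps_scale fps_in_algD mulrDl. Qed.
HB.instance Definition _ := GRing.Zmodule_isLmodule.Build (fps K) (fps A)
  fps_scalerA fps_scale1r fps_scalerDr fps_scalerDl.

Fact fps_scalerAl (c : fps K) (f g : fps A) : c *: (f * g) = (c *: f) * g.
Proof. exact: mulrA. Qed.
HB.instance Definition _ := GRing.Lmodule_isLalgebra.Build (fps K) (fps A)
  fps_scalerAl.
End FpsAlgebra.

(* exp f for a series f without constant term: the terms f ^+ k / k! with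
   k > n do not contribute to the coefficient of degree n. *)
Definition fps_exp (K : comUnitRingType) (A : lalgType K) (f : fps A) : fps A :=
  Fps (fun n => \sum_(k < n.+1) (k`!%:R^-1 : K) *: (f ^+ k) n).

(* The quotient of f by the variable, when f has no constant term. *)
Definition fps_shift (A : Type) (f : fps A) : fps A := Fps (fun n => f n.+1).

Record ideal2 (A : pzRingType) := Ideal2 {
  in_ideal2 :> A -> Prop;
  ideal2_0 : in_ideal2 0;
  ideal2B : forall x y, in_ideal2 x -> in_ideal2 y -> in_ideal2 (x - y);
  ideal2Ml : forall a x, in_ideal2 x -> in_ideal2 (a * x);
  ideal2Mr : forall a x, in_ideal2 x -> in_ideal2 (x * a) }.

Section QuotientRing.
Variables (A : pzRingType) (I : ideal2 A).

(* The chosen representative of the class of x; elements of the quotient are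
   the elements of A that represent their class. *)
Definition qcanon (x : A) : A := choose (fun y => `[< I (x - y) >]) x.

Lemma ideal2N x : I x -> I (- x).
Proof. by move=> Ix; rewrite -sub0r; apply: ideal2B => //; apply: ideal2_0. Qed.
Lemma ideal2D x y : I x -> I y -> I (x + y).
Proof. by move=> Ix Iy; rewrite -[y]opprK; apply: ideal2B => //; apply: ideal2N. Qed.

Lemma qcanonP x : I (x - qcanon x).
Proof.
apply/asboolP; apply: (@chooseP _ (fun y => `[< I (x - y) >])).
by apply/asboolP; rewrite subrr; apply: ideal2_0.
Qed.
Lemma qcanon_eq x y : I (x - y) -> qcanon x = qcanon y.
Proof.
move=> Ixy; have xyE z : `[< I (x - z) >] = `[< I (y - z) >].
  apply/asbool_equiv_eq; split=> Iz.
    by rewrite -(subrKA x); apply: ideal2D => //; rewrite -opprB; apply: ideal2N.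
  by rewrite -(subrKA y); apply: ideal2D.
rewrite /qcanon (eq_choose xyE); apply: choose_id; apply/asboolP.
  by rewrite -opprB; apply: ideal2N.
by rewrite subrr; apply: ideal2_0.
Qed.

Record qring := QRing { qrepr : A; _ : qcanon qrepr == qrepr }.
HB.instance Definition _ := [isSub for qrepr].
HB.instance Definition _ := [Choice of qring by <:].

Fact qpi_subproof x : qcanon (qcanon x) == qcanon x.
Proof.
apply/eqP; apply: qcanon_eq; rewrite -opprB.
by apply: ideal2N; apply: qcanonP.
Qed.
Definition qpi : A -> qring :=
  locked_with ops_key (fun x => QRing (qpi_subproof x)).

Lemma qrepr_pi x : qrepr (qpi x) = qcanon x.
Proof. by rewrite /qpi unlock. Qed.

Lemma qreprK : cancel qrepr qpi.
Proof. by move=> u; apply: val_inj; rewrite /= qrepr_pi; exact/eqP/(valP u). Qed.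
Lemma qpiP x y : qpi x = qpi y <-> I (x - y).
Proof.
split=> [/(congr1 qrepr)|xy]; last first.
  by apply: val_inj; rewrite /= !qrepr_pi; apply: qcanon_eq.
rewrite !qrepr_pi => xy.
rewrite -(subrKA (qcanon x)); apply: ideal2D; first exact: qcanonP.
by rewrite xy -opprB; apply: ideal2N; apply: qcanonP.
Qed.

Definition qzero : qring := qpi 0.
Definition qopp : qring -> qring :=
  locked_with ops_key (fun u => qpi (- qrepr u)).
Definition qadd : qring -> qring -> qring :=
  locked_with ops_key (fun u v => qpi (qrepr u + qrepr v)).

Lemma qpiN x : qpi (- x) = qopp (qpi x).
Proof.
rewrite /qopp unlock.
by apply/qpiP; rewrite -opprD; apply: ideal2N; apply/qpiP; rewrite qreprK. Qed.
Lemma qpi_add x y : qpi (x + y) = qadd (qpi x) (qpi y).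
Proof.
rewrite /qadd unlock; apply/qpiP; rewrite opprD addrACA.
by apply: ideal2D; apply/qpiP; rewrite qreprK.
Qed.

Fact qaddA : associative qadd.
Proof.
move=> u v w; rewrite -(qreprK u) -(qreprK v) -(qreprK w).
by rewrite -!qpi_add addrA.
Qed.
Fact qaddC : commutative qadd.
Proof. by move=> u v; rewrite /qadd unlock addrC. Qed.
Fact qadd0 : left_id qzero qadd.
Proof. by move=> u; rewrite -(qreprK u) -qpi_add add0r. Qed.
Fact qaddN : left_inverse qzero qopp qadd.
Proof. by move=> u; rewrite -(qreprK u) -qpiN -qpi_add addNr. Qed.
HB.instance Definition _ := GRing.isZmodule.Build qring qaddA qaddC qadd0 qaddN.

Lemma qpiD x y : qpi (x + y) = qpi x + qpi y. Proof. exact: qpi_add. Qed.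

Definition qone : qring := qpi 1.
Definition qmul : qring -> qring -> qring :=
  locked_with ops_key (fun u v => qpi (qrepr u * qrepr v)).

Lemma qpiM x y : qpi (x * y) = qmul (qpi x) (qpi y).
Proof.
rewrite /qmul unlock; apply/qpiP; set x' := qrepr _; set y' := qrepr _.
have Ix : I (x - x') by apply/qpiP; rewrite qreprK.
have Iy : I (y - y') by apply/qpiP; rewrite qreprK.
have -> : x * y - x' * y' = (x - x') * y - x' * (y' - y).
  by rewrite mulrBl mulrBr opprB addrA subrK.
apply: ideal2B; first exact: ideal2Mr.
by apply: ideal2Ml; rewrite -opprB; apply: ideal2N.
Qed.

Fact qmulA : associative qmul.
Proof.
move=> u v w; rewrite -(qreprK u) -(qreprK v) -(qreprK w).
by rewrite -!qpiM mulrA.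
Qed.
Fact qmul1 : left_id qone qmul.
Proof. by move=> u; rewrite -(qreprK u) -qpiM mul1r. Qed.
Fact qmulr1 : right_id qone qmul.
Proof. by move=> u; rewrite -(qreprK u) -qpiM mulr1. Qed.
Fact qmulDl : left_distributive qmul +%R.
Proof.
move=> u v w; rewrite -(qreprK u) -(qreprK v) -(qreprK w).
by rewrite -qpiD -!qpiM -qpiD mulrDl.
Qed.
Fact qmulDr : right_distributive qmul +%R.
Proof.
move=> u v w; rewrite -(qreprK u) -(qreprK v) -(qreprK w).
by rewrite -qpiD -!qpiM -qpiD mulrDr.
Qed.
HB.instance Definition _ := GRing.Zmodule_isPzRing.Build qring
  qmulA qmul1 qmulr1 qmulDl qmulDr.

Fact qpi_is_zmod_morphism : zmod_morphism qpi.
Proof. by move=> x y; rewrite qpiD [qpi (- y)]qpiN. Qed.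
HB.instance Definition _ :=
  GRing.isZmodMorphism.Build A qring qpi qpi_is_zmod_morphism.
Fact qpi_is_monoid_morphism : monoid_morphism qpi.
Proof. by split=> // x y; apply: qpiM. Qed.
HB.instance Definition _ :=
  GRing.isMonoidMorphism.Build A qring qpi qpi_is_monoid_morphism.
End QuotientRing.

Section QuotientModule.
Variables (K : comNzRingType) (A : lalgType K) (I : ideal2 A).

Definition qscale (c : K) (u : qring I) : qring I := qpi I c%:A * u.

Fact qscalerA b c u : qscale b (qscale c u) = qscale (b * c) u.
Proof.
by rewrite /qscale mulrA -rmorphM -scalerAl mul1r scalerA.
Qed.
Fact qscale1r : left_id 1 qscale.
Proof. by move=> u; rewrite /qscale scale1r rmorph1 mul1r. Qed.
Fact qscalerDr : right_distributive qscale +%R.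
Proof. by move=> c u v; apply: mulrDr. Qed.
Fact qscalerDl u : {morph qscale^~ u : b c / b + c}.
Proof. by move=> b c; rewrite /qscale scalerDl rmorphD mulrDl. Qed.
HB.instance Definition _ := GRing.Zmodule_isLmodule.Build K (qring I)
  qscalerA qscale1r qscalerDr qscalerDl.

Lemma qscale_mul (c : K) (u : qring I) : c *: u = (c *: (1 : qring I)) * u.
Proof.
have -> : c *: (1 : qring I) = qpi I c%:A by exact: mulr1.
by [].
Qed.
End QuotientModule.

Section GeneratedIdeal.
Variables (A : pzRingType) (rel : A -> A -> Prop).

Inductive gen_ideal : A -> Prop :=
| gen_ideal_rel l r : rel l r -> gen_ideal (l - r)
| gen_ideal_0 : gen_ideal 0
| gen_idealB x y : gen_ideal x -> gen_ideal y -> gen_ideal (x - y)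
| gen_idealMl a x : gen_ideal x -> gen_ideal (a * x)
| gen_idealMr a x : gen_ideal x -> gen_ideal (x * a).

Definition gen_ideal2 : ideal2 A :=
  Ideal2 gen_ideal_0 gen_idealB gen_idealMl gen_idealMr.
End GeneratedIdeal.

Section KernelIdeal.
Variables (A B : pzRingType) (f : {rmorphism A -> B}).

Program Definition ker_ideal2 : ideal2 A := @Ideal2 A (fun x => f x = 0) _ _ _ _.
Next Obligation. exact: rmorph0. Qed.
Next Obligation. by move=> x y /= fx fy; rewrite rmorphB fx fy subrr. Qed.
Next Obligation. by move=> a x /= fx; rewrite rmorphM fx mulr0. Qed.
Next Obligation. by move=> a x /= fx; rewrite rmorphM fx mul0r. Qed.
End KernelIdeal.

(* Closure of an ideal of A[[t]] for the t-adic topology. *)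
Section ClosedIdeal.
Variables (A : pzRingType) (I : ideal2 (fps A)).

Definition adic_closure (f : fps A) : Prop :=
  forall n, exists2 g, I g & forall k, (k < n)%N -> f k = g k.

Program Definition closed_ideal2 : ideal2 (fps A) :=
  @Ideal2 _ adic_closure _ _ _ _.
Next Obligation. by move=> n; exists 0 => //; apply: ideal2_0. Qed.
Next Obligation.
move=> f g If Ig n; have [f' If' ff'] := If n; have [g' Ig' gg'] := Ig n.
exists (f' - g'); first exact: ideal2B.
by move=> k kn; rewrite !fcoefD !fcoefN ff' // gg'.
Qed.
Next Obligation.
move=> a f If n; have [f' If' ff'] := If n.
exists (a * f'); first exact: ideal2Ml.
move=> k kn; rewrite !fcoefM; apply: eq_bigr => j _.
by rewrite ff' // (leq_ltn_trans (leq_subr _ _)).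
Qed.
Next Obligation.
move=> a f If n; have [f' If' ff'] := If n.
exists (f' * a); first exact: ideal2Mr.
move=> k kn; rewrite !fcoefM; apply: eq_bigr => j _.
by rewrite ff' // (leq_trans (ltn_ord j)).
Qed.
End ClosedIdeal.

Inductive ideal_pow (A : pzRingType) (J : A -> Prop) : nat -> A -> Prop :=
| ideal_pow0 x : ideal_pow J 0 x
| ideal_powS n x y : J x -> ideal_pow J n y -> ideal_pow J n.+1 (x * y)
| ideal_pow_0 n : ideal_pow J n 0
| ideal_powB n x y : ideal_pow J n x -> ideal_pow J n y -> ideal_pow J n (x - y).

Section GradedRing.
Variables (A : pzRingType) (J : ideal2 A).

Lemma ideal_powM m n x y :
  ideal_pow J m x -> ideal_pow J n y -> ideal_pow J (m + n)%N (x * y).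
Proof.
move=> Jx Jy; elim: Jx => {m x} [x|m x z Jx _ IH|m|m x z _ IHx _ IHz].
- elim: Jy x => {n y} [y|n y z Jy Jz _|n|n y z _ IHy _ IHz] x /=.
  + exact: ideal_pow0.
  + by rewrite mulrA; apply: ideal_powS => //; apply: ideal2Ml.
  + by rewrite mulr0; apply: ideal_pow_0.
  + by rewrite mulrBr; apply: ideal_powB.
- by rewrite -mulrA addSn; apply: ideal_powS.
- by rewrite mul0r; apply: ideal_pow_0.
- by rewrite mulrBl; apply: ideal_powB.
Qed.

Lemma ideal_pow_sum n k (F : 'I_k -> A) :
  (forall j, ideal_pow J n (F j)) -> ideal_pow J n (\sum_(j < k) F j).
Proof.
move=> JF; elim/big_ind: _ => // [|x y Jx Jy]; first exact: ideal_pow_0.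
rewrite -[y]opprK -[- y]sub0r; do 2![apply: ideal_powB => //].
exact: ideal_pow_0.
Qed.

(* The Rees ring: finitely supported sequences with n-th entry in J ^ n. *)
Definition in_rees (f : fps A) : Prop :=
  (forall n, ideal_pow J n (f n)) /\
  exists N, forall n, (N <= n)%N -> f n = 0.
Definition rees_pred : pred (fps A) := fun f => `[< in_rees f >].

Fact rees_subring_closed : subring_closed rees_pred.
Proof.
split.
- apply/asboolP; split=> [[|n]|]; first exact: ideal_pow0.
    by rewrite fcoef1; apply: ideal_pow_0.
  by exists 1 => -[|n] //; rewrite fcoef1.
- move=> f g /asboolP [Jf [M fM]] /asboolP [Jg [N gN]].
  apply/asboolP; split=> [n|]; first exact: ideal_powB.
  exists (maxn M N) => n; rewrite geq_max fcoefD fcoefN => /andP[Mn Nn].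
  by rewrite fM // gN // subrr.
- move=> f g /asboolP [Jf [M fM]] /asboolP [Jg [N gN]].
  apply/asboolP; split=> [n|].
    rewrite fcoefM; apply: ideal_pow_sum => j.
    by rewrite -{1}(subnKC (leq_ord j)); apply: ideal_powM.
  exists (M + N)%N => n MNn; rewrite fcoefM big1 // => j _.
  have [Mj|jM] := leqP M j; first by rewrite fM // mul0r.
  rewrite gN ?mulr0 // leq_subRL ?leq_ord //.
  by apply: leq_trans MNn; rewrite leq_add2r ltnW.
Qed.
HB.instance Definition _ :=
  GRing.isSubringClosed.Build (fps A) rees_pred rees_subring_closed.

Record rees := Rees { rees_val :> fps A; _ : rees_val \in rees_pred }.
HB.instance Definition _ := [isSub for rees_val].
HB.instance Definition _ := [Choice of rees by <:].
HB.instance Definition _ := GRing.SubChoice_isSubPzRing.Build (fps A) rees_pred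
  rees rees_subring_closed.

Lemma rees_valB f g : rees_val (f - g) = rees_val f - rees_val g.
Proof. exact: (raddfB (val : rees -> fps A)). Qed.
Lemma rees_valM f g : rees_val (f * g) = rees_val f * rees_val g.
Proof. exact: (rmorphM (val : rees -> fps A)). Qed.

Program Definition rees_ideal2 : ideal2 rees :=
  @Ideal2 _ (fun f => forall n, ideal_pow J n.+1 (f n)) _ _ _ _.
Next Obligation. by move=> n; apply: ideal_pow_0. Qed.
Next Obligation. by move=> f g Jf Jg n; rewrite rees_valB; apply: ideal_powB. Qed.
Next Obligation.
move=> a f Jf n; rewrite rees_valM fcoefM; apply: ideal_pow_sum => j.
have /asboolP[Ja _] := valP a.
by rewrite -{1}(subnKC (leq_ord j)) -addnS; apply: ideal_powM.
Qed.
Next Obligation.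
move=> a f Jf n; rewrite rees_valM fcoefM; apply: ideal_pow_sum => j.
have /asboolP[Ja _] := valP a.
by rewrite -{1}(subnKC (leq_ord j)) -addSn; apply: ideal_powM.
Qed.

Definition gr : Type := qring rees_ideal2.
HB.instance Definition _ := GRing.PzRing.on gr.

(* The class of x in J ^ n / J ^ n.+1, when x is in J ^ n (and 0 otherwise). *)
Definition gr_class (n : nat) (x : A) : gr :=
  qpi rees_ideal2 (insubd (0 : rees) (fps_mono n x)).

Definition gr_deg (n : nat) (u : gr) : Prop :=
  exists2 x, ideal_pow J n x & u = gr_class n x.

End GradedRing.

Notation free_alg K X := {malg K[{fmonom X}]}.

Definition fgen {K : comNzRingType} {X : choiceType} (x : X) : free_alg K X :=
  << fmu x >>.

Definition comm (A : pzRingType) (x y : A) : A := x * y - y * x.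

Record is_lie_bracket (K : fieldType) (L : lmodType K) (br : L -> L -> L) : Prop :=
  IsLieBracket {
    lie_linearl : forall y, linear (br^~ y);
    lie_linearr : forall x, linear (br x);
    lie_alternating : forall x, br x x = 0;
    lie_jacobi : forall x y z, br x (br y z) + br y (br z x) + br z (br x y) = 0 }.

Section EnvelopingAlgebra.
Variables (K : fieldType) (L : lmodType K) (br : L -> L -> L).

Inductive uea_rel : free_alg K L -> free_alg K L -> Prop :=
| uea_add x y : uea_rel (fgen (x + y)) (fgen x + fgen y)
| uea_scale c x : uea_rel (fgen (c *: x)) (c *: fgen x)
| uea_comm x y : uea_rel (comm (fgen x) (fgen y)) (fgen (br x y)).

Definition uea : Type := qring (gen_ideal2 uea_rel).
HB.instance Definition _ := GRing.PzRing.on uea.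

Definition uea_in (x : L) : uea := qpi (gen_ideal2 uea_rel) (fgen x).
End EnvelopingAlgebra.

(* L[z, 1/z], as finitely supported functions from exponents to L. *)
Section LoopAlgebra.
Variables (K : fieldType) (L : lmodType K).

Definition finsupp_pred : pred (int -> L) :=
  fun f => `[< finite_set [set k | f k != 0]%classic >].

Fact finsupp_submod_closed : submod_closed finsupp_pred.
Proof.
split=> [|c f g /asboolP ff /asboolP fg]; apply/asboolP.
  by rewrite (_ : mkset _ = set0) //; apply/seteqP; split=> // k /negP; case; apply/eqP.
apply: (@sub_finite_set _ _ ([set k | f k != 0] `|` [set k | g k != 0])%classic).
  move=> k /=; have [f0|] := eqVneq (f k) 0; last by left.
  by rewrite -[_ k]/(c *: f k + g k) f0 scaler0 add0r; right.
by rewrite finite_setU.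
Qed.
HB.instance Definition _ :=
  GRing.isSubmodClosed.Build K (int -> L) finsupp_pred finsupp_submod_closed.

Record loop := Loop { loop_val :> int -> L; _ : loop_val \in finsupp_pred }.
HB.instance Definition _ := [isSub for loop_val].
HB.instance Definition _ := [Choice of loop by <:].
HB.instance Definition _ := [SubChoice_isSubZmodule of loop by <:].
HB.instance Definition _ := [SubZmodule_isSubLmodule of loop by <:].

Definition loop_mono_fun (x : L) (k : int) : int -> L :=
  fun n => if n == k then x else 0.
Fact loop_mono_subproof x k : loop_mono_fun x k \in finsupp_pred.
Proof.
apply/asboolP; apply: (@sub_finite_set _ _ [set k]%classic) => //.
by move=> n /=; rewrite /loop_mono_fun; case: (n =P k) => // _; rewrite eqxx.
Qed.
Definition loop_mono x k : loop := Loop (loop_mono_subproof x k).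

Definition loop_eval1 (f : loop) : L := \sum_(k \in [set: int]) f k.

Variables (br : L -> L -> L) (br_lie : is_lie_bracket br).

Definition loop_br_fun (f g : loop) : int -> L :=
  fun n => \sum_(k \in [set: int]) br (f k) (g (n - k)).

Fact loop_br_subproof f g : loop_br_fun f g \in finsupp_pred.
Proof.
have br0l y : br 0 y = 0.
  by have := lie_linearl br_lie y (-1) 0 0; rewrite scaler0 addr0 scaleN1r addNr.
have br0r x : br x 0 = 0.
  by have := lie_linearr br_lie x (-1) 0 0; rewrite scaler0 addr0 scaleN1r addNr.
have /asboolP ff := valP f; have /asboolP fg := valP g.
apply/asboolP; apply: sub_finite_set (finite_image2 (fun k l : int => k + l) ff fg).
move=> n /=; apply: contra_neqP => nfg; apply: fsbig1 => k _.
have [->|fk] := eqVneq (f k) 0; first exact: br0l.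
have [->|gk] := eqVneq (g (n - k)) 0; first exact: br0r.
case: nfg; exists k => //; exists (n - k) => //.
by rewrite addrC subrK.
Qed.
Definition loop_br (f g : loop) : loop := Loop (loop_br_subproof f g).
End LoopAlgebra.

Section FiniteDimensional.
Variables (K : fieldType) (g : vectType K) (br : g -> g -> g).

Definition brv (U V : {vspace g}) : {vspace g} :=
  <<[seq br u v | u <- vbasis U, v <- vbasis V]>>%VS.

Definition lie_ideal (V : {vspace g}) : Prop :=
  forall x y, y \in V -> br x y \in V.
Definition lie_solvable (V : {vspace g}) : Prop :=
  exists n, iter n (fun W => brv W W) V = 0%VS.
Definition lie_nilpotent (V : {vspace g}) : Prop :=
  exists n, iter n (brv V) V = 0%VS.

Definition lie_semisimple : Prop :=
  forall V, lie_ideal V -> lie_solvable V -> V = 0%VS.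

Record cartan_subalgebra (h : {vspace g}) : Prop := CartanSubalgebra {
  cartan_sub : forall x y, x \in h -> y \in h -> br x y \in h;
  cartan_nilpotent : lie_nilpotent h;
  cartan_self_normalizing :
    forall x, (forall y, y \in h -> br x y \in h) -> x \in h }.

Record invariant_form (B : g -> g -> K) : Prop := InvariantForm {
  form_linearl : forall y, scalar (B^~ y);
  form_linearr : forall x, scalar (B x);
  form_invariant : forall x y z, B (br x y) z = B x (br y z);
  form_nondegenerate : forall x, (forall y, B x y = 0) -> x = 0 }.

Variable h : {vspace g}.
Notation dual := 'Hom(subvs_of h, K^o).

Definition root_vector (b : dual) (x : g) : Prop :=
  forall t : subvs_of h, br (vsval t) x = (b t : K) *: x.
Definition is_root (b : dual) : Prop :=
  b != 0 /\ exists2 x, x != 0 & root_vector b x.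

Record simple_roots (I : finType) (alpha : I -> dual) : Prop := SimpleRoots {
  simple_is_root : forall i, is_root (alpha i);
  simple_free : free [seq alpha i | i : I];
  simple_span : forall b, is_root b -> exists n : I -> nat,
    b = \sum_i alpha i *+ n i \/ b = - \sum_i alpha i *+ n i }.

(* The form on the dual of h obtained from the restriction of B to h. *)
Variable B : g -> g -> K.
Definition dual_vector (b : dual) : subvs_of h :=
  xget 0 [set t | forall x : subvs_of h, B (vsval t) (vsval x) = b x]%classic.
Definition dual_form (b c : dual) : K :=
  B (vsval (dual_vector b)) (vsval (dual_vector c)).
Definition coroot (b : dual) : g :=
  (2 / dual_form b b) *: vsval (dual_vector b).
End FiniteDimensional.

(* A complex semisimple Lie algebra with the choices made in its presentation:
   Cartan subalgebra, simple roots, invariant form, and Chevalley generators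
   e_i, f_i. *)
Record semisimple_data (R : realType) := SemisimpleData {
  ss_alg : vectType R[i];
  ss_br : ss_alg -> ss_alg -> ss_alg;
  ss_lie : is_lie_bracket ss_br;
  ss_semisimple : lie_semisimple ss_br;
  ss_cartan : {vspace ss_alg};
  ss_cartanP : cartan_subalgebra ss_br ss_cartan;
  ss_form : ss_alg -> ss_alg -> R[i];
  ss_formP : invariant_form ss_br ss_form;
  ss_I : finType;
  ss_alpha : ss_I -> 'Hom(subvs_of ss_cartan, R[i]^o);
  ss_alphaP : simple_roots ss_br ss_alpha;
  ss_a : ss_I -> ss_I -> int;
  ss_aE : forall i j, (ss_a i j)%:~R =
    2 * dual_form ss_form (ss_alpha i) (ss_alpha j)
      / dual_form ss_form (ss_alpha i) (ss_alpha i);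
  ss_e : ss_I -> ss_alg;
  ss_f : ss_I -> ss_alg;
  ss_eP : forall i, root_vector ss_br (ss_alpha i) (ss_e i);
  ss_fP : forall i, root_vector ss_br (- ss_alpha i) (ss_f i);
  ss_efP : forall i, ss_br (ss_e i) (ss_f i) = coroot ss_form (ss_alpha i) }.

Definition ss_d (R : realType) (D : semisimple_data R) (i : ss_I D) : R[i] :=
  dual_form (@ss_form R D) (ss_alpha i) (ss_alpha i) / 2.

Section Yangian.
Variables (R : realType) (I : finType) (a : I -> I -> int) (d : I -> R[i]).
Local Notation C := R[i].
Local Notation "''hbar'" := ('X : {poly C}).

(* inl (true, i, r), inl (false, i, r), inr (i, r) index
   x^+_{i,r}, x^-_{i,r}, xi_{i,r} *)
Definition Ygen : Type := (bool * I * nat + I * nat)%type.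
HB.instance Definition _ := Choice.on Ygen.
Local Notation F := (free_alg {poly C} Ygen).

Definition FYx (e : bool) (i : I) (r : nat) : F := fgen (inl (e, i, r) : Ygen).
Definition FYxi (i : I) (r : nat) : F := fgen (inr (i, r) : Ygen).

Definition pm (e : bool) : C := if e then 1 else -1.
Definition Ybeta e i j : {poly C} := (pm e * d i * (a i j)%:~R / 2)%:P * 'hbar.

(* The number 1 - a_ij, which is positive for i <> j. *)
Definition serre_len i j : nat := `|1 - a i j|%N.

Inductive Yrel : F -> F -> Prop :=
| Y1 i j r s : Yrel (comm (FYxi i r) (FYxi j s)) 0
| Y2 e i j s :
    Yrel (comm (FYxi i 0) (FYx e j s)) ((pm e * d i * (a i j)%:~R)%:P *: FYx e j s)
| Y3 e i j r s :
    Yrel (comm (FYxi i r.+1) (FYx e j s) - comm (FYxi i r) (FYx e j s.+1))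
         (Ybeta e i j *: (FYxi i r * FYx e j s + FYx e j s * FYxi i r))
| Y4 e i j r s :
    Yrel (comm (FYx e i r.+1) (FYx e j s) - comm (FYx e i r) (FYx e j s.+1))
         (Ybeta e i j *: (FYx e i r * FYx e j s + FYx e j s * FYx e i r))
| Y5 i j r s :
    Yrel (comm (FYx true i r) (FYx false j s)) (if i == j then FYxi i (r + s)%N else 0)
| Y6 e i j (r : 'I_(serre_len i j) -> nat) s : i != j ->
    Yrel (\sum_(p : 'S_(serre_len i j))
            foldr (fun k y => comm (FYx e i (r (p k))) y) (FYx e j s)
                  (enum 'I_(serre_len i j))) 0.

Definition Yangian : Type := qring (gen_ideal2 Yrel).
HB.instance Definition _ := GRing.PzRing.on Yangian.

Definition Yx e i r : Yangian := qpi (gen_ideal2 Yrel) (FYx e i r).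
Definition Yxi i r : Yangian := qpi (gen_ideal2 Yrel) (FYxi i r).

Lemma YscaleE (p : {poly C}) (y : Yangian) : p *: y = (p *: (1 : Yangian)) * y.
Proof. exact: qscale_mul. Qed.

(* Ydeg n is the degree n part of the Yangian: the smallest family of complex
   subspaces, compatible with the product, that has the generators and hbar
   in the prescribed degrees. *)
Inductive Ydeg : nat -> Yangian -> Prop :=
| Ydeg_x e i r : Ydeg r (Yx e i r)
| Ydeg_xi i r : Ydeg r (Yxi i r)
| Ydeg_hbar : Ydeg 1 ('hbar *: (1 : Yangian))
| Ydeg_1 : Ydeg 0 1
| Ydeg_0 n : Ydeg n 0
| YdegB n y z : Ydeg n y -> Ydeg n z -> Ydeg n (y - z)
| YdegM m n y z : Ydeg m y -> Ydeg n z -> Ydeg (m + n)%N (y * z)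
| YdegZ n (c : C) y : Ydeg n y -> Ydeg n (c%:P *: y).

Lemma YdegN n y : Ydeg n y -> Ydeg n (- y).
Proof. by move=> Yy; rewrite -sub0r; apply: YdegB => //; apply: Ydeg_0. Qed.
Lemma YdegD n y z : Ydeg n y -> Ydeg n z -> Ydeg n (y + z).
Proof. by move=> Yy Yz; rewrite -[z]opprK; apply/YdegB/YdegN. Qed.
Lemma Ydeg_sum (T : Type) (r : seq T) (P : pred T) n (F : T -> Yangian) :
  (forall k, P k -> Ydeg n (F k)) -> Ydeg n (\sum_(k <- r | P k) F k).
Proof.
by move=> YF; elim/big_ind: _ => // [|y z]; [apply: Ydeg_0 | apply: YdegD].
Qed.
Lemma Ydeg_monom n (c : C) : Ydeg n ((c%:P * 'hbar ^+ n) *: (1 : Yangian)).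
Proof.
rewrite -scalerA; apply: YdegZ; elim: n => [|n IH].
  by rewrite expr0 scale1r; apply: Ydeg_1.
rewrite exprS -scalerA (YscaleE 'hbar) -[n.+1]add1n.
by apply: YdegM; [apply: Ydeg_hbar | apply: IH].
Qed.

(* Y^0, the subalgebra generated by the xi_{i,r}. *)
Inductive Yzero : Yangian -> Prop :=
| Yzero_xi i r : Yzero (Yxi i r)
| Yzero_1 : Yzero 1
| YzeroB y z : Yzero y -> Yzero z -> Yzero (y - z)
| YzeroM y z : Yzero y -> Yzero z -> Yzero (y * z)
| YzeroZ (p : {poly C}) y : Yzero y -> Yzero (p *: y).

(* The series s = \sum_r xi_{i,r} w ^ (r + 1), with w = 1/u; then t_{i,r} is the
   coefficient of w ^ (r + 1) in
   log(1 + hbar s) / hbar = \sum_(k >= 1) (-1)^(k-1) hbar^(k-1) s^k / k. *)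
Definition Yxi_series i : fps Yangian :=
  Fps (fun n => if n is r.+1 then Yxi i r else 0).
Definition Yt i r : Yangian :=
  \sum_(k < r.+1)
    (((-1) ^+ k / k.+1%:R)%:P * 'hbar ^+ k) *: (Yxi_series i ^+ k.+1) r.+1.

(* The completion \prod_n Y_n, as the ring of series with n-th coefficient
   in Y_n. *)
Definition in_Yhat (y : fps Yangian) : Prop := forall n, Ydeg n (y n).
Definition Yhat_pred : pred (fps Yangian) := fun y => `[< in_Yhat y >].

Fact Yhat_subring_closed : subring_closed Yhat_pred.
Proof.
split=> [|y z /asboolP Yy /asboolP Yz|y z /asboolP Yy /asboolP Yz];
  apply/asboolP => n.
- by rewrite fcoef1; case: n => [|n]; [apply: Ydeg_1 | apply: Ydeg_0].
- exact: YdegB.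
- rewrite fcoefM; apply: Ydeg_sum => k _.
  by rewrite -{1}(subnKC (leq_ord k)); apply: YdegM.
Qed.
HB.instance Definition _ :=
  GRing.isSubringClosed.Build (fps Yangian) Yhat_pred Yhat_subring_closed.

Record Yhat := MkYhat { Yhat_val :> fps Yangian; _ : Yhat_val \in Yhat_pred }.
HB.instance Definition _ := [isSub for Yhat_val].
HB.instance Definition _ := [Choice of Yhat by <:].
HB.instance Definition _ := GRing.SubChoice_isSubPzRing.Build
  (fps Yangian) Yhat_pred Yhat Yhat_subring_closed.

(* C[[hbar]] acts on the completion, with hbar of degree 1. *)
Fact Yhat_scalar_subproof (c : fps C) :
  Fps (fun n => ((c n)%:P * 'hbar ^+ n) *: (1 : Yangian)) \in Yhat_pred.
Proof. by apply/asboolP => n; apply: Ydeg_monom. Qed.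
Definition Yhat_scalar (c : fps C) : Yhat := MkYhat (Yhat_scalar_subproof c).

Definition Yhat_scale (c : fps C) (y : Yhat) : Yhat := Yhat_scalar c * y.

Lemma Yhat_scalarD b c : Yhat_scalar (b + c) = Yhat_scalar b + Yhat_scalar c.
Proof.
apply/val_inj; rewrite raddfD; apply/fpsP => n /=.
by rewrite -scalerDl -mulrDl -polyCD.
Qed.
Lemma Yhat_scalarM b c : Yhat_scalar (b * c) = Yhat_scalar b * Yhat_scalar c.
Proof.
apply/val_inj; rewrite rmorphM; apply/fpsP => n; rewrite fcoefM /= fcoefM.
rewrite rmorph_sum /= mulr_suml scaler_suml; apply: eq_bigr => k _.
by rewrite -YscaleE scalerA polyCM [in RHS]mulrACA -exprD subnKC // leq_ord.
Qed.
Lemma Yhat_scalar1 : Yhat_scalar 1 = 1.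
Proof.
apply/val_inj; rewrite rmorph1; apply/fpsP => -[|n]; rewrite fcoef1 /=.
  by rewrite mulr1 scale1r.
by rewrite mul0r scale0r.
Qed.

Fact Yhat_scalerA b c y :
  Yhat_scale b (Yhat_scale c y) = Yhat_scale (b * c) y.
Proof. by rewrite /Yhat_scale Yhat_scalarM mulrA. Qed.
Fact Yhat_scale1r : left_id 1 Yhat_scale.
Proof. by move=> y; rewrite /Yhat_scale Yhat_scalar1 mul1r. Qed.
Fact Yhat_scalerDr : right_distributive Yhat_scale +%R.
Proof. by move=> c y z; apply: mulrDr. Qed.
Fact Yhat_scalerDl y : {morph Yhat_scale^~ y : b c / b + c}.
Proof. by move=> b c; rewrite /Yhat_scale Yhat_scalarD mulrDl. Qed.
HB.instance Definition _ := GRing.Zmodule_isLmodule.Build (fps C) Yhat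
  Yhat_scalerA Yhat_scale1r Yhat_scalerDr Yhat_scalerDl.

(* A homogeneous y of degree n, as an element of the completion (0 if y is
   not in Y_n). *)
Definition Yhom (n : nat) (y : Yangian) : Yhat :=
  insubd (0 : Yhat) (fps_mono n y).

(* The sum of the z m, when each z m only has components in degrees >= m. *)
Fact Yhat_sum_subproof (z : nat -> Yhat) :
  Fps (fun n => \sum_(m < n.+1) z m n) \in Yhat_pred.
Proof.
by apply/asboolP => n; apply: Ydeg_sum => m _; have /asboolP := valP (z m).
Qed.
Definition Yhat_sum (z : nat -> Yhat) : Yhat := MkYhat (Yhat_sum_subproof z).

(* The completion of Y^0[v], with deg v = 1: its elements are the series
   \sum_m g_m v^m whose coefficients g_m are arbitrary elements of the
   completion of Y^0.  The component of degree 0 of such a series is the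
   component of degree 0 of g_0. *)
Definition Y0v (G : fps Yhat) : Prop := forall m n, Yzero (G m n).
Definition Y0v_plus (G : fps Yhat) : Prop := Y0v G /\ G 0 0 = 0.

Lemma Yt_deg i r : Ydeg r (Yt i r).
Proof.
have low k n : (n < k)%N -> (Yxi_series i ^+ k) n = 0.
  elim: k n => // k IH n nk; rewrite exprS fcoefM big1 // => -[[|j] /= jn] _.
    by rewrite mul0r.
  by rewrite IH ?mulr0 // (leq_trans _ (_ : n <= k)%N) // ltn_subrL /=; case: (n) jn.
have deg k n : (k <= n)%N -> Ydeg (n - k) ((Yxi_series i ^+ k) n).
  elim: k n => [|k IH] n kn.
    rewrite expr0 fcoef1; case: n kn => [|n] _; [exact: Ydeg_1 | exact: Ydeg_0].
  rewrite exprS fcoefM; apply: Ydeg_sum => -[[|j] /= jn] _.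
    by rewrite mul0r; apply: Ydeg_0.
  have [kj|jk] := leqP k (n - j.+1); last by rewrite low // mulr0; apply: Ydeg_0.
  have -> : (n - k.+1 = j + (n - j.+1 - k))%N.
    rewrite -subnDA addnBA; first by rewrite addSnnS subnDl.
    by rewrite -leq_subRL.
  by apply: YdegM; [apply: Ydeg_xi | apply: IH].
apply: Ydeg_sum => k _; rewrite YscaleE -{1}(subnKC (leq_ord k)).
by apply: YdegM; [apply: Ydeg_monom | apply: (deg k.+1 r.+1)].
Qed.
End Yangian.

Section QuantumLoop.
Variables (R : realType) (I : finType) (a : I -> I -> int) (d : I -> R[i]).
Local Notation C := R[i].

(* exp(c hbar) in C[[hbar]] *)
Definition exph (c : C) : fps C := Fps (fun n => c ^+ n / n`!%:R).

(* q_i ^ x, where q_i = exp(hbar d_i / 2) *)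
Definition q_pow i (x : C) : fps C := exph (d i * x / 2).
Definition q_den i : fps C := q_pow i 1 - q_pow i (- 1).

(* hbar / (q_i - q_i^-1).  Quotients by q_i - q_i^-1, here and below, are
   computed after cancelling one power of hbar from both terms; what remains of
   q_i - q_i^-1 is d_i + O(hbar), a unit. *)
Definition h_over_den i : fps C := (fps_shift (q_den i))^-1.

(* [x]_{q_i} = (q_i^x - q_i^-x) / (q_i - q_i^-1) *)
Definition q_num i (x : C) : fps C :=
  fps_shift (q_pow i x - q_pow i (- x)) * h_over_den i.

Definition q_fact i (n : nat) : fps C := \prod_(k < n) q_num i k.+1%:R.
Definition q_binom i (m s : nat) : fps C :=
  q_fact i m / (q_fact i s * q_fact i (m - s)).

(* inl (inl (i, k)), inl (inr (i, k)), inr (i, k) index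
   E_{i,k}, F_{i,k}, H_{i,k} *)
Definition Qgen : Type := (I * int + I * int + I * int)%type.
HB.instance Definition _ := Choice.on Qgen.

(* The free algebra on the generators, completed for the hbar-adic topology. *)
Local Notation F := (fps (free_alg C Qgen)).

Definition FQE (i : I) (k : int) : F := fpsC (fgen (inl (inl (i, k)) : Qgen)).
Definition FQF (i : I) (k : int) : F := fpsC (fgen (inl (inr (i, k)) : Qgen)).
Definition FQH (i : I) (k : int) : F := fpsC (fgen (inr (i, k) : Qgen)).

(* psi_i and phi_i, as series in w = 1/z and in w = z respectively: e is +1
   for psi_i and -1 for phi_i. *)
Definition half_current (e : int) (i : I) : fps F :=
  let c : C := e%:~R in
  fpsC (fps_exp (fps_mono 1 (c * d i / 2) *: FQH i 0)) *
  fps_exp (Fps (fun s : nat =>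
    if s == 0%N then 0 else (fpsC c * q_den i) *: FQH i (e * s%:Z))).

Definition FQpsi (i : I) (n : int) : F :=
  if (0 <= n)%R then half_current 1 i `|n|%N else 0.
Definition FQphi (i : I) (n : int) : F :=
  if (n <= 0)%R then half_current (- 1) i `|n|%N else 0.

(* (psi_{i,n} - phi_{i,n}) / (q_i - q_i^-1) *)
Definition qpsi_phi i n : F :=
  h_over_den i *: fps_shift (FQpsi i n - FQphi i n).

(* Left-hand side of the quantum Serre relation, for X = E or X = F. *)
Definition qserre (X : I -> int -> F) i j
    (k : 'I_(serre_len a i j) -> int) (l : int) : F :=
  let m := serre_len a i j in
  \sum_(p : 'S_m) \sum_(s < m.+1)
    ((-1) ^+ s * q_binom i m s) *:
      ((\prod_(t < m | (t < s)%N) X i (k (p t))) * X j l *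
       (\prod_(t < m | (s <= t)%N) X i (k (p t)))).

Local Notation aC i j := ((a i j)%:~R : C).

Inductive Qrel : F -> F -> Prop :=
| QL1 i j r s : Qrel (comm (FQH i r) (FQH j s)) 0
| QL2E i j k : Qrel (comm (FQH i 0) (FQE j k)) (fpsC (aC i j) *: FQE j k)
| QL2F i j k : Qrel (comm (FQH i 0) (FQF j k)) (- (fpsC (aC i j) *: FQF j k))
| QL3E i j r k : r != 0 ->
    Qrel (comm (FQH i r) (FQE j k))
         ((fpsC (r%:~R^-1) * q_num i (r%:~R * aC i j)) *: FQE j (r + k))
| QL3F i j r k : r != 0 ->
    Qrel (comm (FQH i r) (FQF j k))
         (- ((fpsC (r%:~R^-1) * q_num i (r%:~R * aC i j)) *: FQF j (r + k)))
| QL4E i j k l :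
    Qrel (FQE i (k + 1) * FQE j l - q_pow i (aC i j) *: (FQE j l * FQE i (k + 1)))
         (q_pow i (aC i j) *: (FQE i k * FQE j (l + 1)) - FQE j (l + 1) * FQE i k)
| QL4F i j k l :
    Qrel (FQF i (k + 1) * FQF j l - q_pow i (- aC i j) *: (FQF j l * FQF i (k + 1)))
         (q_pow i (- aC i j) *: (FQF i k * FQF j (l + 1)) - FQF j (l + 1) * FQF i k)
| QL5 i j k l :
    Qrel (comm (FQE i k) (FQF j l)) (if i == j then qpsi_phi i (k + l) else 0)
| QL6E i j k l : i != j -> Qrel (@qserre FQE i j k l) 0
| QL6F i j k l : i != j -> Qrel (@qserre FQF i j k l) 0.

Definition Qideal : ideal2 F := closed_ideal2 (gen_ideal2 Qrel).

Definition Qloop : Type := qring Qideal.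
HB.instance Definition _ := GRing.PzRing.on Qloop.

Definition QE i k : Qloop := qpi Qideal (FQE i k).
Definition QF i k : Qloop := qpi Qideal (FQF i k).
Definition QH i k : Qloop := qpi Qideal (FQH i k).

Local Notation Yangian := (Yangian a d).
Local Notation Yhat := (Yhat a d).

Record geometric_type (Phi : {rmorphism Qloop -> Yhat}) (gp gm : I -> fps Yhat)
    : Prop := GeometricType {
  geo_linear : forall (c : fps C) x, Phi (c *: x) = c *: Phi x;
  geo_H0 : forall i, Phi (QH i 0) = (fpsC ((d i)^-1) : fps C) *: Yhom 0 (Yt a d i 0);
  geo_H : forall i (r : int), r != 0 ->
    Phi (QH i r) = h_over_den i *:
      Yhat_sum (fun k => fpsC ((r%:~R : C) ^+ k / k`!%:R) *: Yhom k (Yt a d i k));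
  geo_gp : forall i, Y0v (gp i);
  geo_gm : forall i, Y0v (gm i);
  geo_E : forall i,
    Phi (QE i 0) = Yhat_sum (fun m => gp i m * Yhom m (Yx a d true i m));
  geo_F : forall i,
    Phi (QF i 0) = Yhat_sum (fun m => gm i m * Yhom m (Yx a d false i m)) }.

Definition constant_term (g : I -> fps Yhat) (c : I -> C) : Prop :=
  forall i, Y0v_plus (g i - fpsC ((fpsC ((c i)^-1) : fps C) *: (1 : Yhat))).

Section GradedMap.
Variable J : ideal2 Qloop.

(* gr(Phi) sends the class of x in J ^ n / J ^ n.+1 to the degree n component
   of Phi x; here it is evaluated on a representative, in the Rees ring, of
   the element of gr J. *)
Definition gr_map (Phi : {rmorphism Qloop -> Yhat}) (u : gr J) : Yangian :=
  \sum_(n \in [set: nat]) Phi (rees_val (qrepr u) n) n.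

(* The map C[hbar] -> gr J, for hbar in J, placing hbar in degree 1. *)
Definition gr_scalar (p : {poly C}) : gr J :=
  \sum_(k < size p) gr_class J k ((fps_mono k p`_k : fps C) *: (1 : Qloop)).

Record degeneration_iso (dp dm : I -> C) (iota : {rmorphism Yangian -> gr J})
    : Prop := DegenerationIso {
  deg_bij : bijective iota;
  deg_linear : forall (p : {poly C}) y, iota (p *: y) = gr_scalar p * iota y;
  deg_graded : forall n y, Ydeg n y -> gr_deg n (iota y);
  deg_xi0 : forall i,
    iota (Yxi a d i 0) = gr_class J 0 ((fpsC (d i) : fps C) *: QH i 0);
  deg_xp0 : forall i,
    iota (Yx a d true i 0) = gr_class J 0 ((fpsC (dp i) : fps C) *: QE i 0);
  deg_xm0 : forall i,
    iota (Yx a d false i 0) = gr_class J 0 ((fpsC (dm i) : fps C) *: QF i 0);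
  deg_xp1 : forall i,
    iota (Yx a d true i 1) =
      gr_class J 1 ((fpsC (dp i) : fps C) *: (QE i 1 - QE i 0));
  deg_xm1 : forall i,
    iota (Yx a d false i 1) =
      gr_class J 1 ((fpsC (dm i) : fps C) *: (QF i 1 - QF i 0)) }.
End GradedMap.
End QuantumLoop.

Section Specialization.
Variables (R : realType) (D : semisimple_data R).

Definition loop_alg : lmodType R[i] := loop (ss_alg D).
Definition loop_alg_br : loop_alg -> loop_alg -> loop_alg := loop_br (ss_lie D).
Definition Uloop : Type := uea loop_alg_br.
HB.instance Definition _ := GRing.PzRing.on Uloop.
Definition Ug : Type := uea (@ss_br R D).
HB.instance Definition _ := GRing.PzRing.on Ug.
Local Notation QloopD := (Qloop (@ss_a R D) (@ss_d R D)).

(* The specialization hbar -> 0: hbar acts by 0 on the target. *)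
Record specialization (sp : {rmorphism QloopD -> Uloop}) : Prop :=
  Specialization {
    sp_linear : forall (c : fps R[i]) (x : QloopD), sp (c *: x) = c 0 *: sp x;
    sp_E : forall i k, sp (QE _ _ i k) = uea_in loop_alg_br (loop_mono (ss_e i) k);
    sp_F : forall i k, sp (QF _ _ i k) = uea_in loop_alg_br (loop_mono (ss_f i) k);
    sp_H : forall i k, sp (QH _ _ i k) =
      uea_in loop_alg_br (loop_mono (coroot (@ss_form R D) (ss_alpha i)) k) }.

(* The evaluation z -> 1. *)
Record evaluation (ev : {rmorphism Uloop -> Ug}) : Prop := Evaluation {
  ev_linear : forall (c : R[i]) (x : Uloop), ev (c *: x) = c *: ev x;
  ev_in : forall l : loop_alg,
    ev (uea_in loop_alg_br l) = uea_in (@ss_br R D) (loop_eval1 l) }.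

Definition Jideal (sp : {rmorphism QloopD -> Uloop}) (ev : {rmorphism Uloop -> Ug}) :
  ideal2 QloopD := ker_ideal2 (ev \o sp).
End Specialization.

(* Main.v *)
Require Import Defs.
From mathcomp Require Import all_boot all_order all_algebra.
From mathcomp Require Import boolp classical_sets functions cardinality fsbigop.
From mathcomp Require Import reals complex monalg.

(** Only the degree 0 and degree 1 components of Phi matter.

    A geometric Phi sends H_{i,r} to xi_{i,0} / d_i + (degree at least 1), for
    every r.  Applying Phi to [H_{i,k}, E_{i,0}] = c E_{i,k}, where c is
    2 + O(hbar ^ 2), and comparing components, gives Phi(E_{i,k}) =
    x^+_{i,0} / d_i^+ in degree 0 and Phi(E_{i,1} - E_{i,0}) = x^+_{i,1} / d_i^+
    in degree 1; the latter rests on [t_{i,1}, x^+_{i,0}] = 2 d_i x^+_{i,1}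
    ([PhiX_coef0], [PhiX_coef1], [Yt1_x]).

    The induced map exists because Phi raises the J-adic filtration to the
    grading filtration, which reduces to: the degree 0 component Phi_0 kills J.
    A direct proof would factor Phi_0 through U(g) and need the Serre
    presentation of g.  The isomorphism iota gives a shortcut: iota o Phi_0 and
    the projection modulo J are two ring morphisms that kill hbar and agree on
    E_{i,k}, F_{i,k}, H_{i,k}, so they are equal; hence iota kills Phi_0(J), and
    iota is injective ([iota_Phi0], [Phi_J]).

    That gr(Phi) is a left inverse of iota is then checked on homogeneous
    elements, which span the Yangian.  The elements y of degree n for which
    iota y is the class of some u in J ^ n with n-th component Phi(u)_n = y
    are stable under the operations of the graded algebra.  They contain
    x_{i,0} and x_{i,1} by the computation above, then the other generators,
    because [t_{i,1}, -] raises r in x_{i,r} ([Ydeg_lifted], [iotaK]).  As iota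
    is bijective, a left inverse is an inverse. *)

Set Implicit Arguments.
Unset Strict Implicit.
Unset Printing Implicit Defensive.

Import GRing.Theory Num.Theory.
Local Open Scope ring_scope.

(** * Free algebras *)

(** [M] is meant to hold on words only, [P] on all elements: this separates
    properties that are multiplicative on words from properties that are only
    additive. *)
Lemma free_alg_ind (K : comNzRingType) (X : choiceType)
    (M P : free_alg K X -> Prop) :
  M 1 -> (forall x m, M m -> M (fgen x * m)) ->
  (forall c m, M m -> P (c *: m)) -> (forall f g, P f -> P g -> P (f + g)) ->
  forall f, P f.
Proof.
move=> M1 Mx PM PD f.
have Mm (m : {fmonom X}) : M << m >>.
  case: m => s; elim: s => [|x s IH]; first by rewrite -fmoneE.
  have -> : << FMonom (x :: s) >> = fgen x * << FMonom s >> :> free_alg K X.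
    rewrite /fgen malgM_def fgmulUU mulr1; congr << _ >>.
    by rewrite /mmul /= fmuE fmmulE.
  exact: Mx.
rewrite [f]monalgE; elim/big_ind: _ => // [|m _].
  by rewrite -(scale0r 1); apply: PM.
suff -> : << f@_m *g m >> = f@_m *: << m >> by apply: PM.
by apply/malgP => k; rewrite mcoeffZ !mcoeffU mulrnAr mulr1.
Qed.

(** Scalars are central although the generators do not commute. *)
Lemma free_alg_scalerAr (K : comNzRingType) (X : choiceType) (c : K)
    (f g : free_alg K X) : f * (c *: g) = c *: (f * g).
Proof.
rewrite (@malgMEw _ _ (msupp f) (msupp g)) ?msuppZ_le //.
rewrite [f * g]malgME scaler_sumr; apply: eq_bigr => k1 _.
rewrite scaler_sumr; apply: eq_bigr => k2 _.
by apply/malgP => k; rewrite mcoeffZ mcoeffU mcoeffZ mulrCA mcoeffU mulrnAr.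
Qed.

(** * Formal power series *)

Lemma sum_ord2 (V : zmodType) (F : nat -> V) : \sum_(k < 2) F k = F 0%N + F 1%N.
Proof. by rewrite big_ord_recl big_ord1. Qed.

Section FpsLow.
Variable A : pzRingType.
Implicit Types f g : fps A.

Lemma fcoefM0 f g : (f * g) 0%N = f 0%N * g 0%N.
Proof. by rewrite fcoefM big_ord1. Qed.

Lemma fcoefM1 f g : (f * g) 1%N = f 0%N * g 1%N + f 1%N * g 0%N.
Proof. by rewrite fcoefM big_ord_recl big_ord1. Qed.

Lemma fcoefM2 f g :
  (f * g) 2%N = f 0%N * g 2%N + f 1%N * g 1%N + f 2%N * g 0%N.
Proof. by rewrite fcoefM 3!big_ord_recl big_ord0 addr0 addrA. Qed.
End FpsLow.

Lemma fpsCN (A : zmodType) (u : A) : - fpsC u = fpsC (- u) :> fps A.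
Proof. by apply/fpsP => -[|n] //=; rewrite oppr0. Qed.

Lemma fps_monoM (A : pzRingType) m n (x y : A) :
  fps_mono m x * fps_mono n y = fps_mono (m + n) (x * y).
Proof.
apply/fpsP => k; rewrite fcoefM /=.
have [->|kmn] := eqVneq k (m + n)%N.
  have mk : (m < (m + n).+1)%N by rewrite ltnS leq_addr.
  rewrite (bigD1 (Ordinal mk)) //= eqxx addKn eqxx big1 ?addr0 // => j jm.
  by rewrite (_ : nat_of_ord j == m = false) ?mul0r //; apply/negP/negP.
apply: big1 => j _; case: eqP => [jm|_]; last by rewrite mul0r.
case: eqP => [kn|_]; last by rewrite mulr0.
by case/eqP: kmn; rewrite -jm -kn subnKC // -ltnS.
Qed.

Lemma fpsCM (A : pzRingType) (u v : A) : fpsC (u * v) = fpsC u * fpsC v.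
Proof. by rewrite fps_monoM. Qed.

Lemma fpsCD (A : zmodType) (u v : A) : fpsC (u + v) = fpsC u + fpsC v.
Proof. by apply/fpsP => -[|n] //=; rewrite addr0. Qed.

Lemma fpsCZ (K : comNzRingType) (A : lalgType K) (c : K) (u : A) :
  fpsC (c *: u) = (fpsC c : fps K) *: (fpsC u : fps A).
Proof.
have -> : (fpsC c : fps K) *: (fpsC u : fps A) = fpsC c%:A * fpsC u.
  congr (_ * _); apply/fpsP => -[|n] //=; by rewrite scale0r.
by rewrite -fpsCM -scalerAl mul1r.
Qed.

(** Isolates the multiples of the variable: a map that kills them is
    determined on constant series. *)
Lemma fps_decomp (K : comNzRingType) (A : lalgType K) (f : fps A) :
  f = fpsC (f 0%N) + (fps_mono 1 1 : fps K) *: fps_shift f.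
Proof.
have -> : (fps_mono 1 1 : fps K) *: fps_shift f = fps_mono 1 1 * fps_shift f.
  congr (_ * _); apply/fpsP => -[|[|n]] //=; by rewrite ?scale0r ?scale1r.
apply/fpsP => -[|n]; rewrite fcoefD ?fcoefM0 ?mul0r ?addr0 //=.
rewrite fcoefM 2!big_ord_recl mul0r add0r mul1r big1 ?addr0 ?add0r => [|j _].
  by rewrite lift0 subSS subn0.
by rewrite mul0r.
Qed.

Section FpsInverse.
Variable K : fieldType.
Implicit Types f g h : fps K.

Lemma fcoef_exp_low h k n : h 0%N = 0 -> (n < k)%N -> (h ^+ k) n = 0.
Proof.
move=> h0; elim: k n => // k IH n nk.
rewrite exprS fcoefM big_ord_recl h0 mul0r add0r big1 // => j _.
case: n nk j => [|n] nk j; first by case: j.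
by rewrite IH ?mulr0 // lift0 subSS (leq_ltn_trans (leq_subr _ _)).
Qed.

(** The inverse of 1 - h, for h without constant term, is the geometric series
    of h, which is truncated here coefficientwise. *)
Lemma fps_unitE f : f 0%N != 0 -> f \is a GRing.unit.
Proof.
move=> f0; pose h : fps K := 1 - fpsC (f 0%N)^-1 * f.
have h0 : h 0%N = 0.
  by rewrite /h fcoefD fcoefN fcoef1 fcoefM big_ord1 mulVf ?subrr.
pose g : fps K := Fps (fun n => \sum_(k < n.+1) (h ^+ k) n).
have gE n j : (j <= n)%N -> g j = (\sum_(k < n.+1) h ^+ k) j.
  move=> jn; have -> : (\sum_(k < n.+1) h ^+ k) j = \sum_(k < n.+1) (h ^+ k) j.
    by elim/big_ind2: _ => // _ x _ y <- <-.
  rewrite /= (big_ord_widen n.+1 (fun k => (h ^+ k) j)) // big_mkcond /=.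
  apply: eq_bigr => k _; case: ifP => // /negbT; rewrite -leqNgt => jk.
  by rewrite fcoef_exp_low.
apply/asboolP; exists (g * fpsC (f 0%N)^-1); rewrite -mulrA.
have -> : fpsC (f 0%N)^-1 * f = 1 - h by rewrite opprB addrC subrK.
apply/fpsP => n.
transitivity (((\sum_(k < n.+1) h ^+ k) * (1 - h)) n).
  by rewrite !fcoefM; apply: eq_bigr => k _; rewrite (gE n) // -ltnS.
rewrite mulrC -opprB mulNr -subrX1 opprB fcoefD fcoefN.
by rewrite fcoef_exp_low // subr0.
Qed.

Lemma fps_inv0 f : f 0%N != 0 -> f^-1 0%N = (f 0%N)^-1.
Proof.
move=> f0; have /fpsP/(_ 0%N) := mulVr (fps_unitE f0).
rewrite fcoefM0 fcoef1 => Hf.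
by apply: (mulIf f0); rewrite Hf mulVf.
Qed.

(** Applied to hbar / (q_i - q_i^-1), whose linear term, if there were one,
    would mix degree 0 into the degree 1 components. *)
Lemma fps_inv1 f : f 0%N != 0 -> f 1%N = 0 -> f^-1 1%N = 0.
Proof.
move=> f0 f1; have /fpsP/(_ 1%N) := mulVr (fps_unitE f0).
rewrite fcoefM1 fcoef1 f1 mulr0 add0r => /eqP.
by rewrite mulf_eq0 (negPf f0) orbF => /eqP.
Qed.
End FpsInverse.

(** * Quotient rings and commutators *)

Lemma qpiZ (K : comNzRingType) (A : lalgType K) (J : ideal2 A) (c : K) (x : A) :
  qpi J (c *: x) = c *: qpi J x.
Proof.
have -> : c *: qpi J x = qpi J c%:A * qpi J x by [].
by rewrite -rmorphM -scalerAl mul1r.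
Qed.

Lemma qpiB (A : pzRingType) (J : ideal2 A) x y :
  qpi J (x - y) = qpi J x - qpi J y.
Proof. exact: rmorphB. Qed.

Lemma qpi_mul (A : pzRingType) (J : ideal2 A) x y :
  qpi J (x * y) = qpi J x * qpi J y.
Proof. exact: rmorphM. Qed.

Lemma qpi_rel (A : pzRingType) (rel : A -> A -> Prop) l r :
  rel l r -> qpi (gen_ideal2 rel) l = qpi (gen_ideal2 rel) r.
Proof. by move=> lr; apply/qpiP; apply: gen_ideal_rel. Qed.

Lemma qpi_comm (A : pzRingType) (J : ideal2 A) x y :
  qpi J (comm x y) = comm (qpi J x) (qpi J y).
Proof. by rewrite rmorphB !rmorphM. Qed.

Lemma qpi_opp (A : pzRingType) (J : ideal2 A) u : qpi J (- u) = - qpi J u.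
Proof. exact: rmorphN. Qed.

Section Commutator.
Variable A : pzRingType.
Implicit Types x y z : A.

Lemma commBl x y z : comm (x - y) z = comm x z - comm y z.
Proof.
rewrite /comm mulrBl mulrBr !opprB [_ - z * x]addrC addrACA.
by rewrite [- (y * z) + _]addrC.
Qed.

Lemma commMl x y z : comm (x * y) z = x * comm y z + comm x z * y.
Proof. by rewrite /comm mulrBr mulrBl !mulrA addrA subrK. Qed.
End Commutator.

(** * Relations in the Yangian *)

Section YangianRelations.
Variables (R : realType) (I : finType) (a : I -> I -> int) (d : I -> R[i]).
Local Notation C := R[i].
Local Notation "''hbar'" := ('X : {poly C}).
Local Notation Y := (Yangian a d).
Local Notation x := (Yx a d).
Local Notation xi := (Yxi a d).
Implicit Types (u v : Y) (p : {poly C}).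

Lemma YscaleAl p u v : p *: u * v = p *: (u * v).
Proof. by rewrite YscaleE [RHS]YscaleE mulrA. Qed.

Lemma YscaleAr p u v : u * (p *: v) = p *: (u * v).
Proof.
rewrite -(qreprK u) -(qreprK v).
transitivity (qpi (gen_ideal2 (Yrel a d)) (p *: (qrepr u * qrepr v))).
  by rewrite -qpiZ -free_alg_scalerAr rmorphM.
by rewrite qpiZ rmorphM.
Qed.

Lemma YcommZl p u v : comm (p *: u) v = p *: comm u v.
Proof. by rewrite /comm YscaleAl YscaleAr scalerBr. Qed.

Lemma YcommZr p u v : comm u (p *: v) = p *: comm u v.
Proof. by rewrite /comm YscaleAl YscaleAr scalerBr. Qed.

Lemma Yxi0_x e i j s :
  comm (xi i 0) (x e j s) = (pm R e * d i * (a i j)%:~R)%:P *: x e j s.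
Proof. by rewrite -qpi_comm (qpi_rel (Y2 a d e i j s)) qpiZ. Qed.

Lemma Yxi1_x e i j s :
  comm (xi i 1) (x e j s) = comm (xi i 0) (x e j s.+1) +
    Ybeta a d e i j *: (xi i 0 * x e j s + x e j s * xi i 0).
Proof.
apply/eqP; rewrite addrC -subr_eq; apply/eqP.
rewrite -!qpi_comm -qpiB (qpi_rel (Y3 a d e i j 0 s)) qpiZ qpiD.
by congr (_ *: (_ + _)); apply: qpi_mul.
Qed.

Lemma Yx_comm i r s : comm (x true i r) (x false i s) = xi i (r + s).
Proof. by rewrite -qpi_comm (qpi_rel (Y5 a d i i r s)) eqxx. Qed.

Lemma Yxi_series0 i : Yxi_series a d i 0%N = 0. Proof. by []. Qed.
Lemma Yxi_series1 i : Yxi_series a d i 1%N = xi i 0. Proof. by []. Qed.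
Lemma Yxi_series2 i : Yxi_series a d i 2%N = xi i 1. Proof. by []. Qed.

Lemma Yt0 i : Yt a d i 0 = xi i 0.
Proof. by rewrite /Yt big_ord1 !expr0 mulr1 !divr1 scale1r expr1. Qed.

Lemma Yt1 i : Yt a d i 1 = xi i 1 - (2^-1%:P * 'hbar) *: (xi i 0 * xi i 0).
Proof.
pose F k := (((-1) ^+ k / k.+1%:R)%:P * 'hbar ^+ k : {poly C}) *:
  (Yxi_series a d i ^+ k.+1) 2%N.
have F0 : F 0%N = xi i 1.
  by rewrite /F !expr0 mulr1 divr1 scale1r expr1 Yxi_series2.
have sq : (Yxi_series a d i ^+ 2) 2%N = xi i 0 * xi i 0.
  by rewrite expr2 fcoefM2 Yxi_series0 mul0r mulr0 add0r addr0 Yxi_series1.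
have F1 : F 1%N = - (2^-1%:P * 'hbar) *: (xi i 0 * xi i 0).
  by rewrite /F sq !expr1 mulN1r polyCN mulNr.
have -> : Yt a d i 1 = F 0%N + F 1%N by exact: sum_ord2.
by rewrite F0 F1 scaleNr.
Qed.

(** The reason for correcting xi_{i,1} into t_{i,1}: the commutator of
    hbar xi_{i,0}^2 / 2 with x_{j,s} cancels the anticommutator in the relation
    between xi_{i,1} and xi_{i,0}, so that t_{i,1} acts as a pure shift. *)
Lemma Yt1_x e i j s :
  comm (Yt a d i 1) (x e j s) = (pm R e * d i * (a i j)%:~R)%:P *: x e j s.+1.
Proof.
pose c : {poly C} := (pm R e * d i * (a i j)%:~R)%:P; rewrite -/c.
have xic : comm (xi i 0) (x e j s) = c *: x e j s by exact: Yxi0_x.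
rewrite Yt1 commBl YcommZl commMl xic YscaleAr YscaleAl -scalerDr Yxi1_x.
rewrite Yxi0_x -/c scalerA (_ : Ybeta a d e i j = 2^-1%:P * 'hbar * c) ?addrK //.
by rewrite /Ybeta polyCM [RHS]mulrC mulrA.
Qed.

(** Monomials in the generators are homogeneous, and a polynomial in hbar is a
    sum of homogeneous scalars. *)
Lemma Yspan (P : Y -> Prop) :
  (forall n y, Ydeg n y -> P y) -> (forall y z, P y -> P z -> P (y + z)) ->
  forall y, P y.
Proof.
move=> PY PD y; rewrite -(qreprK y); move: (qrepr y) => f {y}.
pose M m := exists n, Ydeg n (qpi (gen_ideal2 (Yrel a d)) m).
apply: (@free_alg_ind _ _ M (fun f => P (qpi _ f))) f.
- by exists 0%N; rewrite rmorph1; apply: Ydeg_1.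
- move=> g m [n Yn]; rewrite /M qpi_mul.
  have [k Yk] : M (fgen g).
    by case: g => [[[e i] r]|[i r]]; exists r; [apply: Ydeg_x|apply: Ydeg_xi].
  by exists (k + n)%N; apply: YdegM.
- move=> p m [n Yn]; rewrite qpiZ -[p]coefK poly_def scaler_suml.
  elim/big_ind: _ => // [|k _]; first by apply: (PY 0%N); apply: Ydeg_0.
  rewrite YscaleE; apply: (PY (k + n)%N); apply: YdegM => //.
  by rewrite -mul_polyC; apply: Ydeg_monom.
- by move=> f g Pf Pg; rewrite qpiD; apply: PD.
Qed.
End YangianRelations.

Local Opaque Yx Yxi Yt.

(** * Components in the completed Yangian *)

Section Completion.
Variables (R : realType) (I : finType) (a : I -> I -> int) (d : I -> R[i]).
Local Notation C := R[i].
Local Notation "''hbar'" := ('X : {poly C}).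
Local Notation Y := (Yangian a d).
Local Notation Yhat := (Yhat a d).
Implicit Types (y z : Yhat) (c : fps C).

Lemma YhatD y z n : (y + z) n = y n + z n.
Proof.
exact: (congr1 (fun f : fps Y => f n) (rmorphD (val : Yhat -> fps Y) y z)).
Qed.

Lemma YhatB y z n : (y - z) n = y n - z n.
Proof. exact: (congr1 (fun f : fps Y => f n) (rmorphB (val : Yhat -> fps Y) y z)). Qed.

Lemma Yhat_valM y z : Yhat_val (y * z) = Yhat_val y * Yhat_val z.
Proof. exact: (rmorphM (val : Yhat -> fps Y)). Qed.

Lemma Yhat_comm0 y z : (comm y z) 0%N = comm (y 0%N) (z 0%N).
Proof. by rewrite YhatB !Yhat_valM !fcoefM0. Qed.

Lemma Yhat_comm1 y z :
  (comm y z) 1%N = comm (y 0%N) (z 1%N) + comm (y 1%N) (z 0%N).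
Proof. by rewrite YhatB !Yhat_valM !fcoefM1 [z _ * _ + _]addrC opprD addrACA. Qed.

Lemma YhatZ c y n :
  (c *: y) n = \sum_(k < n.+1) ((c k)%:P * 'hbar ^+ k) *: y (n - k)%N.
Proof.
rewrite -[c *: y]/(Yhat_scalar a d c * y) Yhat_valM fcoefM.
by apply: eq_bigr => k _; rewrite YscaleAl mul1r.
Qed.

Lemma YhatZ0 c y : (c *: y) 0%N = (c 0%N)%:P *: y 0%N.
Proof. by rewrite YhatZ big_ord1 expr0 mulr1. Qed.

Lemma YhatZ1 c y :
  (c *: y) 1%N = (c 0%N)%:P *: y 1%N + ((c 1%N)%:P * 'hbar) *: y 0%N.
Proof. by rewrite YhatZ big_ord_recl big_ord1 expr0 mulr1. Qed.

Lemma YhatZ1_low c y : c 1%N = 0 -> (c *: y) 1%N = (c 0%N)%:P *: y 1%N.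
Proof. by move=> c1; rewrite YhatZ1 c1 mul0r scale0r addr0. Qed.

Lemma YhatZC (c : C) y n : ((fpsC c : fps C) *: y) n = c%:P *: y n.
Proof.
rewrite YhatZ big_ord_recl big1 ?addr0 => [|k _]; last by rewrite mul0r scale0r.
by rewrite expr0 mulr1 subn0.
Qed.

Lemma Yhom_coef m (u : Y) n : Ydeg m u -> Yhom m u n = if n == m then u else 0.
Proof.
move=> Yu; rewrite /Yhom insubdK //; apply/asboolP => k /=.
by case: eqP => [->|_] //; apply: Ydeg_0.
Qed.

Lemma Yhat_sum0 (z : nat -> Yhat) : Yhat_sum z 0%N = z 0%N 0%N.
Proof. exact: big_ord1. Qed.

Lemma Yhat_sum1 (z : nat -> Yhat) : Yhat_sum z 1%N = z 0%N 1%N + z 1%N 1%N.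
Proof. exact: (sum_ord2 (fun k => z k 1%N)). Qed.
End Completion.

(** * Relations in the quantum loop algebra *)

Section QNum.
Variables (R : realType) (I : finType) (d : I -> R[i]).

(** q^x - q^-x is odd in hbar, so dividing it by hbar leaves an even series. *)
Lemma q_pow_diff i x (f := fps_shift (q_pow d i x - q_pow d i (- x))) :
  f 0%N = d i * x /\ f 1%N = 0.
Proof.
rewrite /f /fps_shift /=; split; rewrite ?mulrN ?mulNr.
  rewrite !expr1 (_ : 1`! = 1%N) // !divr1 opprK -mulr2n -[_ *+ 2]mulr_natr.
  by rewrite divfK // pnatr_eq0.
by rewrite sqrrN subrr.
Qed.

Lemma h_over_den0 i : d i != 0 -> h_over_den d i 0%N = (d i)^-1.
Proof.
move=> di; have [f0 _] := q_pow_diff i 1; rewrite mulr1 in f0.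
by rewrite fps_inv0 ?f0.
Qed.

Lemma h_over_den1 i : d i != 0 -> h_over_den d i 1%N = 0.
Proof.
move=> di; have [f0 f1] := q_pow_diff i 1; rewrite mulr1 in f0.
by rewrite fps_inv1 ?f0.
Qed.

Lemma q_num0 i x : d i != 0 -> q_num d i x 0%N = x.
Proof.
move=> di; have [f0 _] := q_pow_diff i x.
by rewrite fcoefM0 f0 h_over_den0 // mulrC mulKf.
Qed.

Lemma q_num1 i x : d i != 0 -> q_num d i x 1%N = 0.
Proof.
move=> di; have [_ f1] := q_pow_diff i x.
by rewrite fcoefM1 f1 mul0r addr0 h_over_den1 ?mulr0.
Qed.
End QNum.

Section LoopRelations.
Variables (R : realType) (I : finType) (a : I -> I -> int) (d : I -> R[i]).
Local Notation C := R[i].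
Local Notation Qloop := (Qloop a d).

(** E and F satisfy the same relations with H up to the sign [pm e]; the sign
    convention is that of [Yx]. *)
Definition QX e i k : Qloop := if e then QE a d i k else QF a d i k.

(** The ideal of the quantum loop algebra is a closure, so a relation is its own
    approximation to every order. *)
Lemma Qpi_rel l r : Qrel a d l r -> qpi (Qideal a d) l = qpi (Qideal a d) r.
Proof.
by move=> lr; apply/qpiP => n; exists (l - r) => //; apply: gen_ideal_rel.
Qed.

Lemma QH0_X e i j k : comm (QH a d i 0) (QX e j k) =
  (fpsC (pm R e * (a i j)%:~R) : fps C) *: QX e j k.
Proof.
case: e; rewrite /QX /pm ?mul1r.
  by rewrite -qpi_comm (Qpi_rel (QL2E a d i j k)) qpiZ.
rewrite -qpi_comm (Qpi_rel (QL2F a d i j k)) qpi_opp qpiZ -scaleNr fpsCN mulN1r.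
by [].
Qed.

Lemma QH_X e i j r k : r != 0 -> comm (QH a d i r) (QX e j k) =
  (fpsC (pm R e) * (fpsC (r%:~R^-1) * q_num d i (r%:~R * (a i j)%:~R)) : fps C)
    *: QX e j (r + k).
Proof.
move=> r0; case: e; rewrite /QX /pm ?mul1r.
  by rewrite -qpi_comm (Qpi_rel (QL3E a d i j k r0)) qpiZ.
by rewrite -qpi_comm (Qpi_rel (QL3F a d i j k r0)) qpi_opp qpiZ -scaleNr -mulN1r fpsCN.
Qed.
End LoopRelations.

(** * Low degree components of a map of geometric type *)

Section GeometricType.
Variables (R : realType) (I : finType) (a : I -> I -> int) (d : I -> R[i]).
Local Notation C := R[i].
Local Notation Yhat := (Yhat a d).
Local Notation x := (Yx a d).
Local Notation xi := (Yxi a d).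
Variables (Phi : {rmorphism Qloop a d -> Yhat}) (gp gm : I -> fps Yhat).
Hypothesis geo : geometric_type Phi gp gm.
Variables dp dm : I -> C.
Hypotheses (gp_dp : constant_term gp dp) (gm_dm : constant_term gm dm).
Hypotheses (d_neq0 : forall i, d i != 0) (a_diag : forall i, a i i = 2).

Definition dpm (e : bool) := if e then dp else dm.

Lemma PhiH_coef0 i r : Phi (QH a d i r) 0%N = ((d i)^-1)%:P *: xi i 0.
Proof.
have [->|r0] := eqVneq r 0.
  by rewrite (geo_H0 geo) YhatZC Yhom_coef ?Yt0 //; apply: Ydeg_xi.
rewrite (geo_H geo) // YhatZ0 h_over_den0 // Yhat_sum0 YhatZC.
by rewrite Yhom_coef ?Yt0 ?divr1 ?scale1r //; apply: Ydeg_xi.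
Qed.

Lemma PhiH0_coef1 i : Phi (QH a d i 0) 1%N = 0.
Proof. by rewrite (geo_H0 geo) YhatZC Yhom_coef ?scaler0 //; apply: Yt_deg. Qed.

Lemma PhiH1_coef1 i : Phi (QH a d i 1) 1%N = ((d i)^-1)%:P *: Yt a d i 1.
Proof.
rewrite (geo_H geo) // YhatZ1_low ?h_over_den1 // h_over_den0 // Yhat_sum1 !YhatZC.
rewrite !Yhom_coef ?scaler0 ?add0r ?expr1 ?divr1 ?scale1r //; apply: Yt_deg.
Qed.

Lemma PhiX0_coef0 e i : Phi (QX a d e i 0) 0%N = ((dpm e i)^-1)%:P *: x e i 0.
Proof.
have coef0 (g : I -> fps Yhat) (D : I -> C) : constant_term g D ->
    g i 0%N 0%N = ((D i)^-1)%:P *: (1 : Yangian a d).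
  move=> /(_ i) [_].
  suff -> : (g i - fpsC ((fpsC (D i)^-1 : fps C) *: (1 : Yhat))) 0%N 0%N =
      g i 0%N 0%N - ((D i)^-1)%:P *: (1 : Yangian a d).
    by move=> /eqP; rewrite subr_eq0 => /eqP.
  have <- : ((fpsC (D i)^-1 : fps C) *: (1 : Yhat)) 0%N =
      ((D i)^-1)%:P *: (1 : Yangian a d) by rewrite YhatZC.
  by rewrite -YhatB.
have E (g : I -> fps Yhat) (D : I -> C) : constant_term g D ->
    Yhat_sum (fun m => g i m * Yhom m (x e i m)) 0%N = ((D i)^-1)%:P *: x e i 0.
  move=> /coef0 gD; rewrite Yhat_sum0 Yhat_valM fcoefM0 gD.
  by rewrite Yhom_coef ?YscaleAl ?mul1r //; apply: Ydeg_x.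
case: e E => E; rewrite /QX /dpm; first by rewrite (geo_E geo); exact: E.
by rewrite (geo_F geo); exact: E.
Qed.

Lemma pm2_inj e : injective (fun u : Yangian a d => (pm R e * 2)%:P *: u).
Proof.
move=> u v /(congr1 (fun w => ((pm R e * 2)^-1)%:P *: w)).
have pm2 : pm R e * 2 != 0.
  by rewrite mulf_eq0 pnatr_eq0 orbF; case: e; rewrite ?oppr_eq0 oner_eq0.
by rewrite !scalerA -polyCM mulVf // !scale1r.
Qed.

Lemma Phi_comm u v : Phi (comm u v) = comm (Phi u) (Phi v).
Proof. by rewrite rmorphB !rmorphM. Qed.

Lemma PhiH0_X0 e i : comm (Phi (QH a d i 0)) (Phi (QX a d e i 0)) =
  (fpsC (pm R e * 2) : fps C) *: Phi (QX a d e i 0).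
Proof. by rewrite -Phi_comm QH0_X a_diag (geo_linear geo). Qed.

(** The scalar c is [2 k]_{q_i} / k up to sign; its linear coefficient vanishes,
    so the degree 1 component of the right-hand side has no contribution from
    degree 0. *)
Lemma PhiH_X0 e i k : k != 0 -> exists2 c : fps C, c 0%N = pm R e * 2 /\ c 1%N = 0 &
  comm (Phi (QH a d i k)) (Phi (QX a d e i 0)) = c *: Phi (QX a d e i k).
Proof.
move=> k0; have E := QH_X a d e i i 0 k0; rewrite addr0 in E.
move: E; set c : fps C := _ * _ => E; exists c; last first.
  by rewrite -Phi_comm E (geo_linear geo).
split; last by rewrite /c 2!fcoefM1 q_num1 // mulr0 !mul0r !addr0 mulr0.
by rewrite /c 2!fcoefM0 q_num0 // a_diag mulKf ?intr_eq0.
Qed.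

Lemma scale_pm2 e i (D : C) (u : Yangian a d) :
  ((d i)^-1)%:P *: (D^-1%:P *: ((pm R e * d i * (2 : int)%:~R)%:P *: u)) =
  (pm R e * 2)%:P *: (D^-1%:P *: u).
Proof.
rewrite 3!scalerA -!polyCM; apply: (congr1 (fun c : C => c%:P *: u)).
by rewrite [_ * d i]mulrC -!mulrA [D^-1 * _]mulrCA mulKf // [LHS]mulrC mulrA.
Qed.

Lemma PhiX_coef0 e i k : Phi (QX a d e i k) 0%N = ((dpm e i)^-1)%:P *: x e i 0.
Proof.
have [->|k0] := eqVneq k 0; first exact: PhiX0_coef0.
have [c [c0 _] /(congr1 (fun y : Yhat => y 0%N))] := PhiH_X0 e i k0.
rewrite Yhat_comm0 PhiH_coef0 PhiX0_coef0 YhatZ0 c0 => E.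
by apply: (@pm2_inj e); rewrite -E YcommZl YcommZr Yxi0_x a_diag scale_pm2.
Qed.

(** Subtracting the degree 1 components of the commutators of H_{i,1} and
    H_{i,0} with X_{i,0} eliminates the unknown degree 1 component of
    Phi(X_{i,0}), since both H's have the same degree 0 component. *)
Lemma PhiX_coef1 e i :
  Phi (QX a d e i 1 - QX a d e i 0) 1%N = ((dpm e i)^-1)%:P *: x e i 1.
Proof.
have /(congr1 (fun y : Yhat => y 1%N)) := PhiH0_X0 e i.
rewrite Yhat_comm1 PhiH0_coef1 PhiH_coef0 YhatZC => E0.
have [c [c0 c1] /(congr1 (fun y : Yhat => y 1%N))] := PhiH_X0 e i (oner_neq0 int).
rewrite Yhat_comm1 PhiH_coef0 PhiH1_coef1 PhiX0_coef0 YhatZ1_low // c0 => E1.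
apply: (@pm2_inj e); rewrite rmorphB YhatB scalerBr -E1 -E0.
have -> : comm 0 (Phi (QX a d e i 0) 0%N) = 0.
  by rewrite /comm mul0r mulr0 subrr.
by rewrite addr0 addrAC subrr add0r YcommZl YcommZr Yt1_x a_diag scale_pm2.
Qed.
End GeometricType.

(** * The graded ring of an ideal *)

Section GradedClass.
Variables (A : pzRingType) (J : ideal2 A).

Lemma fps_mono_rees n x : ideal_pow J n x -> fps_mono n x \in rees_pred J.
Proof.
move=> Jx; apply/asboolP; split=> [k|] /=.
  by case: eqP => [->|_] //; apply: ideal_pow_0.
by exists n.+1 => k nk; rewrite gtn_eqF.
Qed.

Lemma gr_classE n x (Jx : ideal_pow J n x) :
  gr_class J n x = qpi (rees_ideal2 J) (Rees (fps_mono_rees Jx)).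
Proof.
congr qpi; apply: val_inj.
by rewrite insubdK //=; apply: fps_mono_rees.
Qed.

Lemma gr_classB n x y : ideal_pow J n x -> ideal_pow J n y ->
  gr_class J n (x - y) = gr_class J n x - gr_class J n y.
Proof.
move=> Jx Jy; rewrite (gr_classE Jx) (gr_classE Jy) (gr_classE (ideal_powB Jx Jy)).
rewrite -qpiB; congr qpi; apply: val_inj; rewrite [RHS]rees_valB.
by apply/fpsP => k; rewrite fcoefD fcoefN /=; case: eqP; rewrite ?subrr.
Qed.

Lemma gr_classM m n x y : ideal_pow J m x -> ideal_pow J n y ->
  gr_class J (m + n) (x * y) = gr_class J m x * gr_class J n y.
Proof.
move=> Jx Jy; rewrite (gr_classE Jx) (gr_classE Jy) (gr_classE (ideal_powM Jx Jy)).
rewrite -qpi_mul; congr qpi; apply: val_inj.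
by rewrite [RHS]rees_valM fps_monoM.
Qed.

Lemma gr_class1 : gr_class J 0 1 = 1.
Proof.
rewrite (gr_classE (ideal_pow0 J 1)); congr qpi; apply: val_inj.
exact: (esym (rmorph1 (val : rees J -> fps A))).
Qed.

Lemma gr_class_0 n : gr_class J n 0 = 0.
Proof. by have := gr_classB (ideal_pow_0 J n) (ideal_pow_0 J n); rewrite !subrr. Qed.

Lemma gr_class_eq0 n x : ideal_pow J n x -> ideal_pow J n.+1 x -> gr_class J n x = 0.
Proof.
move=> Jx Jx'; rewrite (gr_classE Jx); apply/qpiP; rewrite subr0 => k /=.
by case: eqP => [->|_] //; apply: ideal_pow_0.
Qed.

Lemma ideal_pow1 x : J x -> ideal_pow J 1 x.
Proof. by move=> Jx; rewrite -[x]mulr1; apply: ideal_powS => //; apply: ideal_pow0. Qed.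

Lemma gr_class0_eq x y : J (x - y) -> gr_class J 0 x = gr_class J 0 y.
Proof.
move=> Jxy; apply/eqP; rewrite -subr_eq0 -gr_classB; try exact: ideal_pow0.
by apply/eqP/gr_class_eq0; [apply: ideal_pow0 | apply: ideal_pow1].
Qed.
End GradedClass.

Lemma rees_valD (A : pzRingType) (J : ideal2 A) (f g : rees J) n :
  rees_val (f + g) n = f n + g n.
Proof. exact: (congr1 (fun h : fps A => h n) (raddfD (val : rees J -> fps A) f g)). Qed.

Section LeadingTerm.
Variables (R : realType) (I : finType) (a : I -> I -> int) (d : I -> R[i]).
Local Notation Yhat := (Yhat a d).
Variables (A : pzRingType) (J : ideal2 A) (Phi : {rmorphism A -> Yhat}).
Hypothesis Phi_J : forall x, J x -> Phi x 0%N = 0.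

(** Each of the n factors in J of a product raises the least degree by one. *)
Lemma Phi_low n x m : ideal_pow J n x -> (m < n)%N -> Phi x m = 0.
Proof.
move=> Jx; elim: Jx m => {n x} [x|n x y Jx _ IH|n|n x y _ IHx _ IHy] m //.
- move=> mn; rewrite rmorphM Yhat_valM fcoefM big_ord_recl Phi_J // mul0r add0r.
  rewrite big1 // => j _; rewrite IH ?mulr0 //.
  case: m mn j => [|m] mn j; first by case: j.
  by rewrite lift0 subSS (leq_ltn_trans (leq_subr _ _)).
- by rewrite rmorph0.
- by move=> mn; rewrite rmorphB YhatB IHx // IHy // subrr.
Qed.

(** Below the leading degrees both factors vanish, so a single term of the
    convolution survives; this is why gr(Phi) is multiplicative. *)
Lemma Phi_lead m n x y : ideal_pow J m x -> ideal_pow J n y ->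
  Phi (x * y) (m + n)%N = Phi x m * Phi y n.
Proof.
move=> Jx Jy; rewrite rmorphM Yhat_valM fcoefM.
have mn : (m < (m + n).+1)%N by rewrite ltnS leq_addr.
rewrite (bigD1 (Ordinal mn)) //= addKn big1 ?addr0 // => j jm.
have [jm'|mj] := ltnP j m; first by rewrite (Phi_low Jx) // mul0r.
rewrite (Phi_low Jy) ?mulr0 // ltn_subLR; last by rewrite -ltnS.
by rewrite ltn_add2r ltn_neqAle mj andbT eq_sym.
Qed.
End LeadingTerm.

Section GradedMap.
Variables (R : realType) (I : finType) (a : I -> I -> int) (d : I -> R[i]).
Local Notation C := R[i].
Local Notation Yhat := (Yhat a d).
Variables (J : ideal2 (Qloop a d)) (Phi : {rmorphism Qloop a d -> Yhat}).
Hypothesis Phi_J : forall x, J x -> Phi x 0%N = 0.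

(** [gr_map] is defined on chosen representatives; two representatives differ by
    elements of J ^ n.+1, whose degree n component vanishes by [Phi_low]. *)
Lemma gr_map_qpi (f : rees J) N : (forall n, (N <= n)%N -> f n = 0) ->
  gr_map Phi (qpi (rees_ideal2 J) f) = \sum_(n < N) Phi (f n) n.
Proof.
move=> fN; have E n : Phi (rees_val (qrepr (qpi (rees_ideal2 J) f)) n) n = Phi (f n) n.
  have /(_ n) Jn := qcanonP (rees_ideal2 J) f.
  rewrite rees_valB in Jn.
  have /eqP := Phi_low Phi_J Jn (ltnSn n).
  by rewrite rmorphB YhatB subr_eq0 qrepr_pi => /eqP ->.
rewrite /gr_map (eq_fsbigr (fun n => Phi (f n) n)); last by move=> n _; apply: E.
rewrite (fsbig_ord _ N (fun n => Phi (f n) n)); symmetry; apply: fsbig_widen => //.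
by move=> n [_ /negP]; rewrite -leqNgt => Nn /=; rewrite fN // rmorph0.
Qed.

Lemma gr_mapD (u v : gr J) : gr_map Phi (u + v) = gr_map Phi u + gr_map Phi v.
Proof.
rewrite -(qreprK u) -(qreprK v); move: (qrepr u) (qrepr v) => f g {u v}.
have /asboolP[_ [M fM]] := valP f; have /asboolP[_ [N gN]] := valP g.
have low (h : rees J) K : (forall n, (K <= n)%N -> h n = 0) ->
    forall n, (maxn M N <= n)%N -> (K <= maxn M N)%N -> h n = 0.
  by move=> hK n MNn KMN; apply/hK/(leq_trans KMN).
have fMN n (MNn : (maxn M N <= n)%N) := low f M fM n MNn (leq_maxl M N).
have gMN n (MNn : (maxn M N <= n)%N) := low g N gN n MNn (leq_maxr M N).
rewrite -qpiD (gr_map_qpi fMN) (gr_map_qpi gMN) (@gr_map_qpi _ (maxn M N)).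
  by rewrite -big_split; apply: eq_bigr => n _; rewrite rees_valD rmorphD YhatD.
by move=> n MNn; rewrite rees_valD fMN // gMN // addr0.
Qed.

Lemma gr_map_class n x : ideal_pow J n x -> gr_map Phi (gr_class J n x) = Phi x n.
Proof.
move=> Jx; rewrite (gr_classE Jx) (@gr_map_qpi _ n.+1); last first.
  by move=> k nk /=; rewrite gtn_eqF.
rewrite big_ord_recr /= eqxx big1 ?add0r // => k _.
by rewrite ltn_eqF // rmorph0.
Qed.

Lemma gr_scalarC (c : C) :
  gr_scalar J c%:P = gr_class J 0 ((fpsC c : fps C) *: (1 : Qloop a d)).
Proof.
rewrite /gr_scalar size_polyC; have [->|c0] := eqVneq c 0.
  rewrite big_ord0 (_ : fpsC 0 = 0) ?scale0r ?gr_class_0 //.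
  by apply/fpsP => -[].
by rewrite big_ord1 coefC eqxx.
Qed.

Lemma gr_scalarX :
  gr_scalar J 'X = gr_class J 1 ((fps_mono 1 1 : fps C) *: (1 : Qloop a d)).
Proof.
rewrite /gr_scalar size_polyX.
rewrite (sum_ord2 (fun k =>
  gr_class J k ((fps_mono k 'X`_k : fps C) *: (1 : Qloop a d)))).
rewrite !coefX /= (_ : fpsC 0 = 0) ?scale0r ?gr_class_0 ?add0r //.
by apply/fpsP => -[].
Qed.
End GradedMap.

(** * Inverting the degeneration isomorphism *)

Section Degeneration.
Variables (R : realType) (I : finType) (a : I -> I -> int) (d : I -> R[i]).
Local Notation C := R[i].
Local Notation "''hbar'" := ('X : {poly C}).
Local Notation Y := (Yangian a d).
Local Notation Yhat := (Yhat a d).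
Local Notation Q := (Qloop a d).
Local Notation x := (Yx a d).
Local Notation xi := (Yxi a d).
Variables (Phi : {rmorphism Q -> Yhat}) (gp gm : I -> fps Yhat).
Hypothesis geo : geometric_type Phi gp gm.
Variables dp dm : I -> C.
Hypotheses (gp_dp : constant_term gp dp) (gm_dm : constant_term gm dm).
Hypotheses (dp_neq0 : forall i, dp i != 0) (dm_neq0 : forall i, dm i != 0).
Hypotheses (d_neq0 : forall i, d i != 0) (a_diag : forall i, a i i = 2).
Variables (J : ideal2 Q) (iota : {rmorphism Y -> gr J}).
Hypothesis iotaP : degeneration_iso dp dm iota.
(* Besides iota, all that is used about J: it contains hbar, and modulo J the
   loop index of the generators is irrelevant. *)
Hypothesis J_hbar : forall u : Q, J ((fps_mono 1 1 : fps C) *: u).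
Hypothesis J_X : forall e i k, J (QX a d e i k - QX a d e i 0).
Hypothesis J_H : forall i k, J (QH a d i k - QH a d i 0).

Local Notation D := (dpm dp dm).
Local Notation cls := (gr_class J 0).

Lemma dpm_neq0 e i : D e i != 0. Proof. by case: e; rewrite /dpm. Qed.

Lemma QscaleE (c : fps C) (u : Q) : c *: u = (c *: (1 : Q)) * u.
Proof. exact: qscale_mul. Qed.

Lemma clsZ n c (u : Q) : ideal_pow J n u ->
  gr_class J n ((fpsC c : fps C) *: u) = gr_scalar J c%:P * gr_class J n u.
Proof.
move=> Ju; rewrite gr_scalarC QscaleE -{1}[n]add0n gr_classM //.
exact: ideal_pow0.
Qed.

Lemma iota_x e i : iota (x e i 0) = cls ((fpsC (D e i) : fps C) *: QX a d e i 0).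
Proof. by case: e; [apply: (deg_xp0 iotaP)|apply: (deg_xm0 iotaP)]. Qed.

Lemma iota_x1 e i : iota (x e i 1) =
  gr_class J 1 ((fpsC (D e i) : fps C) *: (QX a d e i 1 - QX a d e i 0)).
Proof. by case: e; [apply: (deg_xp1 iotaP)|apply: (deg_xm1 iotaP)]. Qed.

Lemma clsZK c (u : Q) : c != 0 ->
  gr_scalar J (c^-1)%:P * cls ((fpsC c : fps C) *: u) = cls u.
Proof.
move=> c0; rewrite -clsZ; last exact: ideal_pow0.
rewrite scalerA -fpsCM mulVf // (_ : fpsC 1 = 1) ?scale1r //.
Qed.

Lemma iota_Phi0_gen (g : Qgen I) :
  iota (Phi (qpi (Qideal a d) (fpsC (fgen g))) 0%N) =
  cls (qpi (Qideal a d) (fpsC (fgen g))).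
Proof.
have caseX e i k : iota (Phi (QX a d e i k) 0%N) = cls (QX a d e i k).
  rewrite (PhiX_coef0 geo gp_dp gm_dm d_neq0 a_diag) (deg_linear iotaP) iota_x.
  rewrite clsZK; last exact: dpm_neq0.
  exact: esym (gr_class0_eq (J_X e i k)).
case: g => [[[i k]|[i k]]|[i k]]; [exact: (caseX true)|exact: (caseX false)|].
rewrite -/(QH a d i k) (PhiH_coef0 geo d_neq0) (deg_linear iotaP) (deg_xi0 iotaP).
rewrite clsZK; last exact: d_neq0.
exact: esym (gr_class0_eq (J_H i k)).
Qed.

(** Both sides are ring morphisms in u that kill the multiples of hbar, so it is
    enough to compare them on the generators. *)
Lemma iota_Phi0 u : iota (Phi u 0%N) = cls u.
Proof.
rewrite -(qreprK u); move: (qrepr u) => f {u}.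
have D0 (u v : Q) : cls (u + v) = cls u + cls v.
  rewrite -{1}[v]opprK -[- v]sub0r !gr_classB ?gr_class_0 ?sub0r ?opprK //;
    exact: ideal_pow0.
have hbar0 (u : Q) : cls ((fps_mono 1 1 : fps C) *: u) = 0.
  by rewrite -(gr_class_0 J 0); apply: gr_class0_eq; rewrite subr0; apply: J_hbar.
rewrite [f](@fps_decomp C) qpiD qpiZ rmorphD YhatD rmorphD D0 hbar0.
rewrite (geo_linear geo) YhatZ0 scale0r rmorph0 !addr0.
move: (f 0%N) => {}f.
pose P f := iota (Phi (qpi (Qideal a d) (fpsC f)) 0%N) =
  cls (qpi (Qideal a d) (fpsC f)).
apply: (@free_alg_ind _ _ P P) f; rewrite /P.
- have -> : qpi (Qideal a d) (fpsC 1) = 1 by [].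
  have -> : Phi 1 0%N = 1 by rewrite rmorph1.
  by rewrite rmorph1 gr_class1.
- move=> g m IH; rewrite fpsCM qpi_mul rmorphM Yhat_valM fcoefM0 rmorphM.
  rewrite iota_Phi0_gen IH -gr_classM //; exact: ideal_pow0.
- move=> c m IH; rewrite fpsCZ qpiZ (geo_linear geo) YhatZC (deg_linear iotaP) IH.
  by rewrite clsZ //; apply: ideal_pow0.
- by move=> g h IHg IHh; rewrite fpsCD qpiD rmorphD YhatD rmorphD IHg IHh D0.
Qed.

(** By [iota_Phi0] the degree 0 component of Phi vanishes wherever the class
    modulo J does, since iota is injective. *)
Lemma Phi_J u : J u -> Phi u 0%N = 0.
Proof.
move=> Ju; apply: (bij_inj (deg_bij iotaP)).
rewrite iota_Phi0 rmorph0 -(gr_class_0 J 0); apply: gr_class0_eq.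
by rewrite subr0.
Qed.

(** For y of degree n this amounts to [gr_map Phi (iota y) = y], but the witness
    u makes the stability under products visible. *)
Definition lifted n (y : Y) : Prop :=
  exists2 u, ideal_pow J n u & iota y = gr_class J n u /\ Phi u n = y.

Lemma liftedB n y z : lifted n y -> lifted n z -> lifted n (y - z).
Proof.
move=> [u Ju [yu uy]] [v Jv [zv vz]]; exists (u - v); first exact: ideal_powB.
by rewrite rmorphB yu zv gr_classB // rmorphB YhatB uy vz.
Qed.

Lemma liftedM m n y z : lifted m y -> lifted n z -> lifted (m + n) (y * z).
Proof.
move=> [u Ju [yu uy]] [v Jv [zv vz]]; exists (u * v); first exact: ideal_powM.
by rewrite rmorphM yu zv gr_classM // (Phi_lead Phi_J Ju Jv) uy vz.
Qed.

Lemma liftedZ n c y : lifted n y -> lifted n (c%:P *: y).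
Proof.
move=> [u Ju [yu uy]]; exists ((fpsC c : fps C) *: u).
  by rewrite QscaleE -[n]add0n; apply: ideal_powM => //; apply: ideal_pow0.
by rewrite (deg_linear iotaP) yu clsZ // (geo_linear geo) YhatZC uy.
Qed.

Lemma lifted_comm m n y z : lifted m y -> lifted n z -> lifted (m + n) (comm y z).
Proof.
move=> Ly Lz; apply: liftedB; first exact: liftedM.
by rewrite addnC; apply: liftedM.
Qed.

Lemma lifted_hbar : lifted 1 ('hbar *: (1 : Y)).
Proof.
exists ((fps_mono 1 1 : fps C) *: (1 : Q)); first by apply: ideal_pow1.
rewrite (deg_linear iotaP) rmorph1 mulr1 gr_scalarX; split=> //.
by rewrite (geo_linear geo) YhatZ1 rmorph1 scale0r add0r mul1r.
Qed.

Lemma lifted_x0 e i : lifted 0 (x e i 0).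
Proof.
exists ((fpsC (D e i) : fps C) *: QX a d e i 0); first exact: ideal_pow0.
split; first exact: iota_x.
rewrite (geo_linear geo) YhatZC (PhiX_coef0 geo gp_dp gm_dm d_neq0 a_diag).
by rewrite scalerA -polyCM divff ?scale1r ?dpm_neq0.
Qed.

Lemma lifted_x1 e i : lifted 1 (x e i 1).
Proof.
exists ((fpsC (D e i) : fps C) *: (QX a d e i 1 - QX a d e i 0)).
  rewrite QscaleE; apply: ideal_pow1; apply: ideal2Ml; apply: J_X.
split; first exact: iota_x1.
rewrite (geo_linear geo) YhatZC (PhiX_coef1 geo gp_dp gm_dm d_neq0 a_diag).
by rewrite scalerA -polyCM divff ?scale1r ?dpm_neq0.
Qed.

Lemma lifted_xi0 i : lifted 0 (xi i 0).
Proof. by rewrite -[0%N]/(0 + 0)%N -Yx_comm; apply: lifted_comm; apply: lifted_x0. Qed.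

Lemma lifted_t1 i : lifted 1 (Yt a d i 1).
Proof.
rewrite Yt1; apply: liftedB.
  by have := lifted_comm (lifted_x1 true i) (lifted_x0 false i); rewrite Yx_comm.
rewrite -scalerA; apply: liftedZ; rewrite YscaleE.
by apply: (liftedM lifted_hbar (liftedM (lifted_xi0 i) (lifted_xi0 i))).
Qed.

(** For a fixed i, t_{i,1} and x_{i,0} generate all the x_{i,r}, as a_ii and d_i
    are nonzero. *)
Lemma lifted_x e i r : lifted r (x e i r).
Proof.
elim: r => [|r IH]; first exact: lifted_x0.
pose c := pm R e * d i * (2 : int)%:~R.
have c0 : c != 0.
  by rewrite /c !mulf_neq0 ?intr_eq0 //; case: e {IH c}; rewrite ?oppr_eq0 oner_eq0.
have -> : x e i r.+1 = (c^-1)%:P *: comm (Yt a d i 1) (x e i r).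
  by rewrite Yt1_x a_diag scalerA -polyCM mulVf // scale1r.
by apply: liftedZ; rewrite -add1n; apply: lifted_comm => //; apply: lifted_t1.
Qed.

Lemma Ydeg_lifted n y : Ydeg n y -> lifted n y.
Proof.
elim=> {n y}.
- exact: lifted_x.
- move=> i r; rewrite -[r]addn0 -Yx_comm; apply: lifted_comm; exact: lifted_x.
- exact: lifted_hbar.
- exists 1; first exact: ideal_pow0.
  by rewrite !rmorph1 gr_class1.
- move=> n; exists 0; first exact: ideal_pow_0.
  by rewrite !rmorph0 gr_class_0.
- by move=> n y z _ Ly _ Lz; apply: liftedB.
- by move=> m n y z _ Ly _ Lz; apply: liftedM.
- by move=> n c y _ Ly; apply: liftedZ.
Qed.

Lemma iotaK : cancel iota (gr_map Phi).
Proof.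
apply: Yspan => [n y /Ydeg_lifted [u Ju [-> <-]]|y z Ey Ez].
  exact: (gr_map_class Phi_J Ju).
by rewrite rmorphD (gr_mapD Phi_J) Ey Ez.
Qed.
End Degeneration.

Lemma loop_eval1_mono (K : fieldType) (L : lmodType K) (v : L) k :
  loop_eval1 (loop_mono v k) = v.
Proof.
rewrite /loop_eval1 -(fsbig_widen [set k]%classic) //; last first.
  by move=> n [_ /= nk]; rewrite /loop_mono_fun; case: eqP.
by rewrite fsbig_set1 /= /loop_mono_fun eqxx.
Qed.

Theorem proposition6p5 (R : realType) (D : semisimple_data R)
  (sp : {rmorphism Qloop (@ss_a R D) (@ss_d R D) -> Uloop D})
  (sp_spec : specialization sp)
  (ev : {rmorphism Uloop D -> Ug D})
  (ev_spec : evaluation ev)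
  (Phi : {rmorphism Qloop (@ss_a R D) (@ss_d R D) ->
                    Yhat (@ss_a R D) (@ss_d R D)})
  (gp gm : ss_I D -> fps (Yhat (@ss_a R D) (@ss_d R D)))
  (Phi_geometric : geometric_type Phi gp gm)
  (dp dm : ss_I D -> R[i])
  (dp_neq0 : forall i, dp i != 0)
  (dm_neq0 : forall i, dm i != 0)
  (dp_dm : forall i, dp i * dm i = ss_d i)
  (gp_dp : constant_term gp dp)
  (gm_dm : constant_term gm dm)
  (iota : {rmorphism Yangian (@ss_a R D) (@ss_d R D) -> gr (Jideal sp ev)})
  (iota_degeneration : degeneration_iso dp dm iota) :
  cancel iota (gr_map Phi) /\ cancel (gr_map Phi) iota.
Proof.
(* Nonvanishing of d_i = d_i^+ d_i^- makes (alpha_i, alpha_i) nonzero, whence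
   a_ii = 2. *)
have d_neq0 i : @ss_d R D i != 0 by rewrite -dp_dm mulf_neq0.
have a_diag i : @ss_a R D i i = 2.
  apply: (@intr_inj R[i]); rewrite ss_aE mulfK //.
  by apply: contraNneq (d_neq0 i) => E; rewrite /ss_d E mul0r.
suff K : cancel iota (gr_map Phi).
  by split=> //; apply/(bij_can_sym (deg_bij iota_degeneration)).
apply: (iotaK Phi_geometric gp_dp gm_dm dp_neq0 dm_neq0 d_neq0 a_diag
  iota_degeneration) => [u|e i k|i k]; rewrite /Jideal /=.
- by rewrite (sp_linear sp_spec) scale0r rmorph0.
- rewrite !rmorphB; case: e; rewrite /QX ?(sp_E sp_spec) ?(sp_F sp_spec);
  by rewrite !(ev_in ev_spec) !loop_eval1_mono subrr.
- by rewrite !rmorphB !(sp_H sp_spec) !(ev_in ev_spec) !loop_eval1_mono subrr.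
Qed.
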